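(* Let $n\ge 1$ and let $m\ge 3$ be odd. Let $\alpha_0,\dots,\alpha_{m-1}\in\mathbb{R}$ satisfy $\mathrm{sign}\,\alpha_k\ne(-1)^k$ for at least one value of $k\in\{1,\dots,m-1\}$, and let $u$ be the solution of $$(-\Delta)^m u(r)=e^{u(r)},\quad u(0)=\alpha_0,\ u'(0)=0,\quad \Delta^k u(0)=\alpha_k,\ (\Delta^k u)'(0)=0\ \text{ for any } k\in\{1,\dots,m-1\}.$$ Then $u$ is a solution of $(-\Delta)^m u=e^u$ in $\mathbb{R}^n$ which is stable outside a compact set.
   Context: A function $u=u(r)$ of $r\ge 0$ is identified with the radial function $x\mapsto u(|x|)$ on $\mathbb{R}^n$ (for $n=1$: an even function), and $\Delta u(r)=u''(r)+\frac{n-1}{r}u'(r)$ for $r>0$. Solutions are classical ($C^{2m}$, including at the origin) and taken on their maximal interval of continuation. For $m$ odd, a solution $u\in C^{2m}(\mathbb{R}^n)$ of $(-\Delta)^m u=e^u$ in $\mathbb{R}^n$ is called stable outside a compact set $K\subset\mathbb{R}^n$ if $$\int_{\mathbb{R}^n}|\nabla(\Delta^{\frac{m-1}{2}}\varphi)|^2dx-\int_{\mathbb{R}^n}e^u\varphi^2dx\ge 0\qquad\text{for any }\varphi\in C^\infty_c(\mathbb{R}^n\setminus K).$$ It is stable outside a compact set if such a $K$ exists. *)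

(* Defs.v *)
From HB Require Import structures.
From mathcomp Require Import all_boot all_order all_algebra.
From mathcomp Require Import all_classical all_reals all_analysis.

Set Implicit Arguments.
Unset Strict Implicit.
Unset Printing Implicit Defensive.

Import Order.TTheory GRing.Theory Num.Theory.
Import numFieldNormedType.Exports.

Local Open Scope classical_set_scope.
Local Open Scope ring_scope.

(* R^n is ['rV[R]_n].  Its library norm is the sup norm, which induces the
   usual topology; the Euclidean norm is defined separately. *)
Definition enorm (R : realType) (n : nat) (x : 'rV[R]_n) : R :=
  Num.sqrt (\sum_(i < n) x ord0 i ^+ 2).

(* For T = +oo this is the whole space. *)
Definition eball (R : realType) (n : nat) (T : \bar R) : set 'rV[R]_n :=
  [set x | ((enorm x)%:E < T)%E].

Definition pderiv (R : realType) (n : nat) (i : 'I_n) (f : 'rV[R]_n -> R) :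
  'rV[R]_n -> R := fun x => 'D_(delta_mx ord0 i) f x.

(* Only meant for an open set O, where it says that all the iterated partial
   derivatives of f up to order k exist and are continuous. *)
Fixpoint Ck (R : realType) (n k : nat) (O : set 'rV[R]_n)
    (f : 'rV[R]_n -> R) : Prop :=
  (forall x, O x -> {for x, continuous f}) /\
  if k is k'.+1 then
    forall i : 'I_n, (forall x, O x -> derivable f x (delta_mx ord0 i)) /\
                     Ck k' O (pderiv i f)
  else True.

Definition laplacian (R : realType) (n : nat) (f : 'rV[R]_n -> R) :
  'rV[R]_n -> R := fun x => \sum_(i < n) pderiv i (pderiv i f) x.

Definition sqnorm_grad (R : realType) (n : nat) (f : 'rV[R]_n -> R) :
  'rV[R]_n -> R := fun x => \sum_(i < n) pderiv i f x ^+ 2.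

(* Lebesgue measure on R^n, as the n-fold product of the Lebesgue measure on
   the line.  The library has a product sigma-algebra on tuples but none on
   row vectors, so the measure lives on [n.-tuple R]. *)
Definition cons_pair (R : realType) (n : nat)
    (p : measurableTypeR R * n.-tuple (measurableTypeR R)) :
  n.+1.-tuple (measurableTypeR R) := [tuple of p.1 :: p.2].

Lemma measurable_cons_pair (R : realType) (n : nat) :
  measurable_fun setT (@cons_pair R n).
Proof. exact: measurable_cons. Qed.

Section lebesgue_tupleS.
Context (R : realType) (n : nat)
  (mu : {sigma_finite_measure set (n.-tuple (measurableTypeR R)) -> \bar R}).

Definition lebesgue_tupleS : set (n.+1.-tuple (measurableTypeR R)) -> \bar R :=
  pushforward (lebesgue_measure \x mu)%E (@cons_pair R n).

Let lebesgue_tupleS0 : lebesgue_tupleS set0 = 0%E.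
Proof. by rewrite /lebesgue_tupleS /pushforward preimage_set0 measure0. Qed.

Let lebesgue_tupleS_ge0 A : (0 <= lebesgue_tupleS A)%E.
Proof. by rewrite /lebesgue_tupleS /pushforward; exact: measure_ge0. Qed.

Let lebesgue_tupleS_sigma_additive : semi_sigma_additive lebesgue_tupleS.
Proof.
move=> F mF tF mUF; rewrite /lebesgue_tupleS /pushforward preimage_bigcup.
have mpre A : measurable A -> measurable (@cons_pair R n @^-1` A).
  by move=> mA; rewrite -[X in measurable X]setTI; exact: measurable_cons_pair.
apply: measure_semi_sigma_additive.
- by move=> i; exact: mpre.
- apply/trivIsetP => i j _ _ ij; rewrite -preimage_setI.
  by move/trivIsetP : tF => /(_ _ _ _ _ ij) ->//; rewrite preimage_set0.
- by rewrite -preimage_bigcup; exact: mpre.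
Qed.

HB.instance Definition _ := isMeasure.Build _ _ _ lebesgue_tupleS
  lebesgue_tupleS0 lebesgue_tupleS_ge0 lebesgue_tupleS_sigma_additive.

Lemma lebesgue_tupleS_sigma_finite : sigma_finite setT lebesgue_tupleS.
Proof.
have [F FT mF] : sigma_finite setT (lebesgue_measure \x mu)%E.
  have /sigma_finiteP[F [TF ndF Foo]] :=
    sigma_finiteT (lebesgue_measure : {sigma_finite_measure set _ -> \bar R}).
  have /sigma_finiteP[G [TG ndG Goo]] := sigma_finiteT mu.
  exists (fun i => F i `*` G i).
    rewrite -setXTT TF TG predeqE => -[x y]; split.
      move=> [/= [i _ Fix] [j _ Gjy]]; exists (maxn i j) => //; split.
      - by move: x Fix; exact/subsetPset/ndF/leq_maxl.
      - by move: y Gjy; exact/subsetPset/ndG/leq_maxr.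
    by move=> [i _ []/= ? ?]; split; exists i.
  move=> k; have [? ?] := Foo k; have [? ?] := Goo k.
  split; first exact: measurableX.
  by rewrite product_measure1E// lte_mul_pinfty// ge0_fin_numE.
pose uncons (t : n.+1.-tuple (measurableTypeR R)) := (thead t, [tuple of behead t]).
have consK : cancel (@cons_pair R n) uncons.
  by move=> [a t]; congr pair; apply/val_inj.
have munc : measurable_fun setT uncons.
  apply: measurable_fun_pair; first exact: measurable_tnth.
  exact: measurable_behead.
exists (fun i => uncons @^-1` F i).
  by rewrite -preimage_bigcup -FT preimage_setT.
move=> i; have [mFi Fioo] := mF i; split.
  by rewrite -[X in measurable X]setTI; exact: munc.
rewrite /lebesgue_tupleS /pushforward -comp_preimage.
by rewrite (_ : uncons \o _ = id) //; apply/funext => x /=; exact: consK.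
Qed.

HB.instance Definition _ := @Measure_isSigmaFinite.Build _ _ _
  lebesgue_tupleS lebesgue_tupleS_sigma_finite.

End lebesgue_tupleS.

Fixpoint lebesgue_tuple (R : realType) (n : nat) :
    {sigma_finite_measure set (n.-tuple (measurableTypeR R)) -> \bar R} :=
  if n is n'.+1 then lebesgue_tupleS (lebesgue_tuple R n')
  else \d_([tuple] : 0.-tuple (measurableTypeR R)).

Definition integral_Rn (R : realType) (n : nat) (f : 'rV[R]_n -> R) : \bar R :=
  (\int[lebesgue_tuple R n]_t (f (\row_(i < n) tnth t i))%:E)%E.

Definition radial (R : realType) (n : nat) (u : R -> R) : 'rV[R]_n -> R :=
  fun x => u (enorm x).

(* Laplacian of a radial function in terms of its profile w on [0, +oo); at
   r = 0 it is the continuous extension.  Values at r < 0 play no role. *)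
Definition radlap (R : realType) (n : nat) (w : R -> R) : R -> R :=
  let L := fun r => derive1 (derive1 w) r + n.-1%:R / r * derive1 w r in
  fun r => if r == 0 then lim (L @ 0^'+) else L r.

(* Classical solution on [0, T), i.e. on the ball of radius T, of
   (-Delta)^m u(r) = e^(u(r)) with Delta^k u(0) = alpha_k and
   (Delta^k u)'(0) = 0 for 0 <= k < m.  Derivatives at r = 0 are those of the
   even extension. *)
Definition radial_solution (R : realType) (n m : nat) (alpha : 'I_m -> R)
    (T : \bar R) (u : R -> R) : Prop :=
  [/\ (0 < T)%E,
      Ck (2 * m) (@eball R n T) (@radial R n u),
      forall r : R, 0 < r -> (r%:E < T)%E ->
        iter m (fun w s => - radlap n w s) u r = expR (u r) &
      forall k : 'I_m, iter k (radlap n) u 0 = alpha k /\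
        is_derive (0 : R) 1 (fun r => iter k (radlap n) u `|r|) 0].

(* [0, T) is the maximal interval of continuation of u. *)
Definition maximal_radial_solution (R : realType) (n m : nat)
    (alpha : 'I_m -> R) (T : \bar R) (u : R -> R) : Prop :=
  radial_solution n alpha T u /\
  forall (T' : \bar R) (v : R -> R), (T < T')%E -> radial_solution n alpha T' v ->
    ~ (forall r : R, 0 <= r -> (r%:E < T)%E -> v r = u r).

Definition entire_solution (R : realType) (n m : nat) (u : 'rV[R]_n -> R) :
    Prop :=
  Ck (2 * m) setT u /\
  forall x, iter m (fun f y => - laplacian f y) u x = expR (u x).

(* C_c^oo(R^n \ K), its elements being extended by zero to R^n. *)
Definition test_function (R : realType) (n : nat) (K : set 'rV[R]_n)
    (phi : 'rV[R]_n -> R) : Prop :=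
  [/\ forall k, Ck k setT phi,
      compact (closure [set x | phi x != 0]) &
      closure [set x | phi x != 0] `<=` ~` K].

Definition stable_outside (R : realType) (n m : nat) (u : 'rV[R]_n -> R)
    (K : set 'rV[R]_n) : Prop :=
  forall phi, test_function K phi ->
    (0 <= integral_Rn (sqnorm_grad (iter (m.-1)./2 (@laplacian R n) phi))
          - integral_Rn (fun x => expR (u x) * phi x ^+ 2)%R)%E.

Definition stable_outside_compact (R : realType) (n m : nat)
    (u : 'rV[R]_n -> R) : Prop :=
  exists K : set 'rV[R]_n, compact K /\ stable_outside m u K.

(* Main.v *)
(* Write [v_k = Delta^k u], so that [Delta v_(m-1) = - exp u] because [m] is odd.

   Global existence: [v_(m-1)] is bounded above by its value at the origin, hence
   so is, by successive integration of [(r^(n-1) f')' = r^(n-1) Delta f], each [v_k]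
   on a bounded interval.  Thus [exp u] is bounded there, and the solution of the
   equation started at radius [T / 2] exists beyond [T].

   Decay: going down from [k = m], as long as [(-Delta)^(k+1) u > 0] everywhere the
   function [(-Delta)^k u] is strictly decreasing, so either it is positive
   everywhere, or it stays below a negative constant near infinity.  By the sign
   hypothesis the second alternative occurs for some [k >= 1].  If [k] is odd, then
   [v_k] is eventually bounded below by a positive constant, so that [u] tends to
   [+oo] and [v_(m-1)], hence [u], to [-oo], a contradiction.  So [k] is even and
   integrating [v_k <= - c] gives [u r <= - e r^2] near infinity.

   Stability: since [int (Delta g)^2 = sum_ij int (d_i d_j g)^2], iterating a
   weighted Hardy inequality bounds [int |grad Delta^((m-1)/2) phi|^2] from below by
   [4^-m int (1 + |x|^2)^-(n+m) phi^2] when [phi] vanishes on the unit ball, and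
   this weight dominates [exp u] outside a large ball. *)
Require Import Defs.
From mathcomp Require Import all_boot all_order all_algebra.
From mathcomp Require Import all_classical all_reals all_analysis.
From mathcomp Require Import measurable_realfun ring lra.
Set Implicit Arguments.
Unset Strict Implicit.
Unset Printing Implicit Defensive.
Import Order.TTheory GRing.Theory Num.Theory.
Import numFieldNormedType.Exports.
Local Open Scope classical_set_scope.
Local Open Scope ring_scope.

(** * Calculus of derivatives *)

(** The equation is used as [(r^N f')' = r^N h] with [N = n - 1], on intervals of positive radii,
    together with limits of [f] and [f'] at [0+]; the singular coefficient [N / r] is thus never met
    at [r = 0]. No solution is built at the origin: continuation restarts at a positive radius,
    where the initial value problem is regular, and an exponentially weighted norm makes Picard
    iteration global for a Lipschitz right-hand side. The delicate passage is between a profile and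
    its radial function, because the profile's Laplacian at [0] is a limit; its existence comes from
    the regularity of the radial function on the ball. In the stability part, Hardy's inequality
    with weight [|x|^-2] has a constant that vanishes in dimension 2. High powers of a bounded
    weight avoid this in every dimension. They decay faster than the classical weight, which is
    affordable because a Gaussian bound on [exp u] beats every inverse power. This quadratic decay
    of [u] needs at least one integration of a negative constant, hence a failing sign at some
    [k >= 1]. *)

Section pointwise_continuity.
Context {R : realType} {V : topologicalType}.
Implicit Types (f g : V -> R) (x : V).

Lemma for_continuous_cst x (c : R) : {for x, continuous (fun _ : V => c)}.
Proof. exact: cst_continuous. Qed.

Lemma for_continuousD f g x : {for x, continuous f} -> {for x, continuous g} ->
  {for x, continuous (fun y => f y + g y)}.
Proof. exact: cvgD. Qed.

Lemma for_continuousN f x : {for x, continuous f} ->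
  {for x, continuous (fun y => - f y)}.
Proof. exact: cvgN. Qed.

Lemma for_continuousM f g x : {for x, continuous f} -> {for x, continuous g} ->
  {for x, continuous (fun y => f y * g y)}.
Proof. exact: cvgM. Qed.

Lemma for_continuousV f x : f x != 0 -> {for x, continuous f} ->
  {for x, continuous (fun y => (f y)^-1)}.
Proof. exact: cvgV. Qed.

Lemma for_continuous_comp (g : R -> R) f x : {for x, continuous f} ->
  {for f x, continuous g} -> {for x, continuous (fun y => g (f y))}.
Proof. exact: continuous_comp. Qed.

Lemma for_continuousX f x n : {for x, continuous f} ->
  {for x, continuous (fun y => f y ^+ n)}.
Proof.
move=> cf; apply: (@for_continuous_comp (fun s => s ^+ n)) => //.
exact: exprn_continuous.
Qed.

Lemma for_continuous_near f g x : (\forall y \near x, f y = g y) ->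
  {for x, continuous f} -> {for x, continuous g}.
Proof.
move=> fg cf; rewrite /prop_for /continuous_at -(nbhs_singleton fg).
exact: (cvg_trans (near_eq_cvg fg) cf).
Qed.

Lemma for_continuous_sum (I : Type) (s : seq I) (F : I -> V -> R) x :
  (forall i, {for x, continuous (F i)}) ->
  {for x, continuous (fun y => \sum_(i <- s) F i y)}.
Proof.
move=> cF; elim: s => [|i s IH].
  rewrite (_ : (fun y => _) = (fun=> 0)); first exact: for_continuous_cst.
  by apply/funext => y; rewrite big_nil.
rewrite (_ : (fun y => _) = (fun y => F i y + \sum_(i <- s) F i y)).
  exact: for_continuousD.
by apply/funext => y; rewrite big_cons.
Qed.

End pointwise_continuity.

Section directional_derivatives.
Context {R : realType} {V : normedModType R}.
Implicit Types (f g : V -> R) (x v : V).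

Lemma der_eq f x v (a b : R) : a = b -> is_derive x v f a -> is_derive x v f b.
Proof. by move=> ->. Qed.

Lemma der_cst x v (c : R) : is_derive x v (fun _ => c) 0.
Proof. exact: is_derive_cst. Qed.

Lemma derD f g x v (a b : R) : is_derive x v f a -> is_derive x v g b ->
  is_derive x v (fun y => f y + g y) (a + b).
Proof. exact: is_deriveD. Qed.

Lemma derN f x v (a : R) : is_derive x v f a -> is_derive x v (fun y => - f y) (- a).
Proof. exact: is_deriveN. Qed.

Lemma derB f g x v (a b : R) : is_derive x v f a -> is_derive x v g b ->
  is_derive x v (fun y => f y - g y) (a - b).
Proof. exact: is_deriveB. Qed.

Lemma derM f g x v (a b : R) : is_derive x v f a -> is_derive x v g b ->
  is_derive x v (fun y => f y * g y) (f x * b + a * g x).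
Proof. by move=> fa gb; rewrite (mulrC a); exact: is_deriveM. Qed.

Lemma derZ f x v (c a : R) : is_derive x v f a ->
  is_derive x v (fun y => c * f y) (c * a).
Proof. by move=> fa; exact: (@is_deriveZ _ _ _ f c x v a fa). Qed.

(** The chain rule of the line is applied to [h |-> f (h *: v + x)] at [h = 0], so a derivative of
    [f] in the single direction [v] is enough. *)
Lemma der_comp (g : R -> R) f x v (a b : R) : is_derive x v f a ->
  is_derive (f x) 1 g b -> is_derive x v (fun y => g (f y)) (b * a).
Proof.
move=> [df fa] gb; have /derivable1P df1 := df.
pose k (h : R) := f (h *: v + x).
have k0 : k 0 = f x by rewrite /k scale0r add0r.
have kE : is_derive (0 : R) 1 k a.
  apply: DeriveDef => //; rewrite -fa /derive.
  set g1 := fun h => h^-1 *: _; set g2 := fun h => h^-1 *: _.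
  suff -> : g1 = g2 by [].
  by apply/funext => h; rewrite /g1 /g2 /k /= addr0 scale0r add0r [_%:A]mulr1.
have gk : is_derive (k 0) 1 g b by rewrite k0.
have [dgk gka] := @is_derive1_comp _ g k 0 _ _ gk kE.
apply: DeriveDef; first by apply/derivable1P.
rewrite -gka /derive.
set g1 := fun h => h^-1 *: _; set g2 := fun h => h^-1 *: _.
suff -> : g1 = g2 by [].
by apply/funext => h; rewrite /g1 /g2 /k /= addr0 scale0r add0r [_%:A]mulr1.
Qed.

Lemma derX f x v (n : nat) (a : R) : is_derive x v f a ->
  is_derive x v (fun y => f y ^+ n) (n%:R * f x ^+ n.-1 * a).
Proof.
move=> fa; have := @is_deriveX _ _ f n x v a fa.
by rewrite exprfctE.
Qed.

Lemma derV f x v (a : R) : f x != 0 -> is_derive x v f a ->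
  is_derive x v (fun y => (f y)^-1) (- (f x) ^- 2 * a).
Proof.
move=> fx0 [df <-]; apply: DeriveDef; first exact: derivableV.
by rewrite deriveV.
Qed.

End directional_derivatives.

Section real_line.
Context {R : realType}.
Implicit Types (f g : R -> R) (a b r : R).

Lemma der_id r : is_derive r 1 (fun x : R => x) 1.
Proof. exact: is_derive_id. Qed.

Lemma der_continuous f r d : is_derive r 1 f d -> {for r, continuous f}.
Proof. by move=> [/derivable1_diffP df _]; exact: differentiable_continuous. Qed.

Lemma der_near f g r d : (\forall x \near r, f x = g x) ->
  is_derive r 1 f d -> is_derive r 1 g d.
Proof. exact: near_eq_is_derive. Qed.

Lemma der_unique f r d d' : is_derive r 1 f d -> is_derive r 1 f d' -> d = d'.
Proof. by move=> [_ <-] [_ <-]. Qed.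

Lemma mean_value f f' a b : a < b ->
  (forall x, a <= x <= b -> is_derive x 1 f (f' x)) ->
  exists2 c, a < c < b & f b - f a = f' c * (b - a).
Proof.
move=> ab df; have [] := @MVT R f f' a b ab.
- by move=> x /[!in_itv]/= /andP[? ?]; apply: df; rewrite !ltW.
- apply: derivable_within_continuous => x /[!in_itv]/= /df [].
  by [].
- by move=> c /[!in_itv]/= ? ?; exists c.
Qed.

Lemma der_le0_nincr f f' a b : a <= b ->
  (forall x, a <= x <= b -> is_derive x 1 f (f' x)) ->
  (forall x, a < x < b -> f' x <= 0) -> f b <= f a.
Proof.
rewrite le_eqVlt => /predU1P[->//|ab] df f0.
have [c cab E] := mean_value ab df.
by rewrite -subr_le0 E mulr_le0_ge0 ?f0// subr_ge0 ltW.
Qed.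

Lemma der_lt0_decr f f' a b : a < b ->
  (forall x, a <= x <= b -> is_derive x 1 f (f' x)) ->
  (forall x, a < x < b -> f' x < 0) -> f b < f a.
Proof.
move=> ab df f0.
have [c cab E] := mean_value ab df.
by rewrite -subr_lt0 E nmulr_rlt0 ?f0// subr_gt0.
Qed.

Lemma nincr_le_lim f f' b l r : 0 < r < b -> f x @[x --> 0^'+] --> l ->
  (forall x, 0 < x < b -> is_derive x 1 f (f' x)) ->
  (forall x, 0 < x < b -> f' x <= 0) -> f r <= l.
Proof.
move=> /andP[r0 rb] fl df f0.
apply: (cvgr_to_ge fl); near=> x.
have x0 : 0 < x by near: x; exact: nbhs_right_gt.
have xr : x < r by near: x; exact: nbhs_right_lt.
apply: (@der_le0_nincr f f') => [|y|y].
- exact: ltW.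
- by move=> /andP[xy yr]; apply: df; rewrite (lt_le_trans x0 xy) (le_lt_trans yr).
- by move=> /andP[xy yr]; apply: f0; rewrite (lt_trans x0 xy) (lt_trans yr).
Unshelve. all: by end_near. Qed.

End real_line.

(** * The radial Laplace equation on an interval *)

Section radial_laplace_equation.
Context {R : realType} (N : nat).
Implicit Types (f h : R -> R) (a b r : R).

(* [f'' + (N / r) f' = h] on [(a, b)] with [f1 = f'], in divergence form. *)
Definition radlap_eq a b f f1 h := forall r, a < r < b ->
  is_derive r 1 f (f1 r) /\ is_derive r 1 (fun s => s ^+ N * f1 s) (r ^+ N * h r).

Lemma radlap_eqN a b f f1 h : radlap_eq a b f f1 h ->
  radlap_eq a b (fun r => - f r) (fun r => - f1 r) (fun r => - h r).
Proof.
move=> fh r /fh[df dg]; split; first exact: derN.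
apply: (@der_eq _ _ _ _ _ (- (r ^+ N * h r))); first by rewrite mulrN.
by under eq_fun do rewrite mulrN; exact: derN.
Qed.

Lemma radlap_eqZ (c : R) a b f f1 h : radlap_eq a b f f1 h ->
  radlap_eq a b (fun r => c * f r) (fun r => c * f1 r) (fun r => c * h r).
Proof.
move=> fh r /fh[df dg]; split; first exact: derZ.
apply: (@der_eq _ _ _ _ _ (c * (r ^+ N * h r))); first by rewrite mulrCA.
by under eq_fun do rewrite mulrCA; exact: derZ.
Qed.

Lemma radlap_eqB a b f f1 h g g1 k :
  radlap_eq a b f f1 h -> radlap_eq a b g g1 k ->
  radlap_eq a b (fun r => f r - g r) (fun r => f1 r - g1 r) (fun r => h r - k r).
Proof.
move=> fh gk r rab; have [df dF] := fh r rab; have [dg dG] := gk r rab.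
split; first exact: derB.
apply: (@der_eq _ _ _ _ _ (r ^+ N * h r - r ^+ N * k r)); first by rewrite mulrBr.
by under eq_fun do rewrite mulrBr; exact: derB.
Qed.

Lemma radlap_eq_sub a b a' b' f f1 h : a <= a' -> b' <= b ->
  radlap_eq a b f f1 h -> radlap_eq a' b' f f1 h.
Proof.
move=> aa bb fh r /andP[ar rb]; apply: fh.
by rewrite (le_lt_trans aa ar) (lt_le_trans rb bb).
Qed.

Lemma derXn r n : is_derive r 1 (fun s : R => s ^+ n) (n%:R * r ^+ n.-1).
Proof.
by apply: (der_eq _ (derX n (der_id r))); rewrite mulr1.
Qed.

(** The flux [s ^+ N * f1 s] is nonincreasing and tends to 0 at the origin. For [N = 0] the factor
    [s ^+ N] does not help, and the limit is that of [f1]. *)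
Lemma radlap_grad_le0 b f f1 h : radlap_eq 0 b f f1 h ->
  f1 x @[x --> 0^'+] --> 0 -> (forall r, 0 < r < b -> h r <= 0) ->
  forall r, 0 < r < b -> f1 r <= 0.
Proof.
move=> fh f10 h0 r rb; have r0 : 0 < r by case/andP: rb.
have G0 : s ^+ N * f1 s @[s --> 0^'+] --> 0.
  rewrite -[X in _ --> X](mulr0 (0 ^+ N)); apply: cvgM => //.
  by apply: cvg_at_right_filter; exact: exprn_continuous.
have := @nincr_le_lim _ _ (fun s => s ^+ N * h s) _ _ _ rb G0.
rewrite pmulr_rle0 ?exprn_gt0//; apply => x xb; first by have [] := fh x xb.
by rewrite pmulr_rle0 ?h0// exprn_gt0//; case/andP: xb.
Qed.

Lemma radlap_grad_lt0 b f f1 h : radlap_eq 0 b f f1 h ->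
  f1 x @[x --> 0^'+] --> 0 -> (forall r, 0 < r < b -> h r < 0) ->
  forall r, 0 < r < b -> f1 r < 0.
Proof.
move=> fh f10 h0 r rb; have /andP[r0 rb'] := rb.
(* A limit at the origin yields only a weak inequality; strictness comes from comparing the fluxes
   at [r / 2] and [r]. *)
have h2 : f1 (r / 2) <= 0.
  by apply: (radlap_grad_le0 fh f10) => [x xb|]; [rewrite ltW// h0|lra].
suff : r ^+ N * f1 r < (r / 2) ^+ N * f1 (r / 2).
  move=> /lt_le_trans/(_ (mulr_ge0_le0 _ h2)).
  by rewrite pmulr_rlt0 ?exprn_gt0//; apply; rewrite exprn_ge0// divr_ge0// ltW.
apply: (@der_lt0_decr _ (fun s => s ^+ N * f1 s) (fun s => s ^+ N * h s)); first lra.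
  by move=> x xb; have [] : _ /\ _ := fh x ltac:(lra).
move=> x xb; rewrite pmulr_rlt0 ?exprn_gt0 ?h0//; lra.
Qed.

(** The barrier of the comparison arguments: a paraboloid with constant Laplacian in dimension
    [N.+1], subtracted for growth in [radlap_le_par] and for decay in [radlap_decay]. *)
Lemma radlap_eq_par a b (C : R) :
  radlap_eq a b (fun r => C * r ^+ 2) (fun r => C * (2 * r)) (fun=> 2 * N.+1%:R * C).
Proof.
move=> r _; split.
  by apply: derZ; apply: (der_eq _ (derXn r 2)); rewrite expr1.
rewrite (_ : (fun s => _) = (fun s => 2 * C * s ^+ N.+1)); last first.
  by apply/funext => s; rewrite exprS; ring.
by apply: (der_eq _ (derZ _ (derXn r N.+1))) => /=; ring.
Qed.

Arguments radlap_eq_par : clear implicits.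

(** The difference [f - C r^2] has radial Laplacian at most [C - 2 (N + 1) C <= 0], so its slope is
    nonpositive and it stays below its limit at the origin. *)
Lemma radlap_le_par b f f1 h (f0 C : R) : radlap_eq 0 b f f1 h ->
  f x @[x --> 0^'+] --> f0 -> f1 x @[x --> 0^'+] --> 0 -> 0 <= C ->
  (forall r, 0 < r < b -> h r <= C) ->
  forall r, 0 < r < b -> f1 r <= C * (2 * r) /\ f r <= f0 + C * r ^+ 2.
Proof.
move=> fh ff0 f10 C0 hC.
have gh := radlap_eqB fh (radlap_eq_par 0 b C).
have g1 : forall r, 0 < r < b -> f1 r - C * (2 * r) <= 0.
  apply: (radlap_grad_le0 gh).
    rewrite -[X in _ --> X](subrr 0); apply: cvgB => //.
    rewrite -[X in _ --> X](mulr0 C); apply: cvgM; first exact: cvg_cst.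
    rewrite -[X in _ --> X](mulr0 2); apply: cvgM; first exact: cvg_cst.
    by apply: cvg_at_right_filter; exact: cvg_id.
  move=> x xb; rewrite subr_le0 (le_trans (hC _ xb))// ler_peMl//.
  by rewrite -natrM ler1n.
move=> r rb; split; first by rewrite -subr_le0 g1.
rewrite -lerBlDr.
apply: (@nincr_le_lim _ (fun r => f r - C * r ^+ 2)
  (fun r => f1 r - C * (2 * r)) b _ r rb) => //.
  rewrite -[X in _ --> X](subr0 f0); apply: cvgB => //.
  rewrite -[X in _ --> X](mulr0 C); apply: cvgM; first exact: cvg_cst.
  have : x ^+ 2 @[x --> (0:R)^'+] --> (0:R) ^+ 2.
    by apply: cvg_at_right_filter; exact: exprn_continuous.
  by rewrite expr0n.
by move=> x xb; have [] := gh x xb.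
Qed.

Lemma radlap_decr b f f1 h (f0 : R) : radlap_eq 0 b f f1 h ->
  f x @[x --> 0^'+] --> f0 -> f1 x @[x --> 0^'+] --> 0 ->
  (forall r, 0 < r < b -> h r < 0) ->
  (forall r, 0 < r < b -> f r < f0) /\ (forall r s, 0 < r < s -> s < b -> f s < f r).
Proof.
move=> fh ff0 f10 h0.
have f1n := radlap_grad_lt0 fh f10 h0.
have decr : forall r s, 0 < r < s -> s < b -> f s < f r.
  move=> r s rs sb; apply: (@der_lt0_decr _ f f1); first by case/andP: rs.
    by move=> x xb; have [] : _ /\ _ := fh x ltac:(lra).
  by move=> x xb; apply: f1n; lra.
split=> // r rb; apply: (@lt_le_trans _ _ (f (r / 2))); first by apply: decr; lra.
apply: (@nincr_le_lim _ f f1 b) => //; first lra.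
  by move=> x xb; have [] := fh x xb.
by move=> x xb; rewrite ltW// f1n.
Qed.

Lemma quadratic_dominates (e D E : R) : 0 < e ->
  exists2 r1, 1 <= r1 & forall r, r1 <= r -> E + D * r <= e * r ^+ 2.
Proof.
move=> e0; exists (1 + (`|E| + `|D|) / e).
  by rewrite lerDl divr_ge0// ?ltW// addr_ge0.
move=> r rr; have /andP[r1 re] : (1 <= r) && ((`|E| + `|D|) <= e * r).
  have d0 : 0 <= (`|E| + `|D|) / e by rewrite divr_ge0 ?addr_ge0// ltW.
  apply/andP; split; first by apply: le_trans rr; rewrite lerDl.
  by rewrite [e * r]mulrC -ler_pdivrMr//; apply: le_trans rr; rewrite lerDr.
have := ler_norm E; have := ler_norm D; have := normr_ge0 E; nra.
Qed.

(** The bound on [h] starts only at [a], so the flux at [s0] is an unknown initial term. Once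
    [2 e r^2] is added to [f], this term causes at most linear growth [D r], which half of the
    quadratic term absorbs. *)
Lemma radlap_decay a f f1 h (c : R) : 0 < a -> 0 < c ->
  (forall b, radlap_eq a b f f1 h) -> (forall r, a < r -> h r <= - c) ->
  exists e r1, [/\ 0 < e, 1 <= r1 & forall r, r1 <= r -> f r <= - e * r ^+ 2].
Proof.
move=> a0 c0 fh hc; pose s0 := a + 1.
(* Chosen so that the Laplacian [4 (N + 1) e] of [2 e r^2] is exactly [c]. *)
pose e := c / (4 * N.+1%:R); have e0 : 0 < e by rewrite divr_gt0// mulr_gt0// ltr0n.
have ce : c = e * (4 * N.+1%:R) by rewrite divfK// mulf_neq0// pnatr_eq0.
(* With the absolute value, the flux bound survives division by [s ^+ N >= 1], whatever the sign of
   the slope. *)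
pose D := `|s0 ^+ N * (f1 s0 + 2 * e * (2 * s0))|.
have gk b := radlap_eqB (fh b) (radlap_eq_par a b (- (2 * e))).
have f1D s : s0 <= s -> f1 s + 2 * e * (2 * s) <= D.
  move=> s0s; have s1 : 1 <= s by rewrite /s0 in s0s; lra.
  have : s ^+ N * (f1 s - - (2 * e) * (2 * s)) <=
         s0 ^+ N * (f1 s0 - - (2 * e) * (2 * s0)).
    apply: (@der_le0_nincr _ (fun s => s ^+ N * (f1 s - - (2 * e) * (2 * s)))
      (fun r => r ^+ N * (h r - 2 * N.+1%:R * - (2 * e)))) => //.
      move=> x xs; have [] // := gk (s + 1) x _.
      by rewrite /s0 in xs; lra.
    move=> x /andP[s0x xs]; have ax : a < x by rewrite (lt_trans _ s0x)// ltrDl.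
    rewrite mulr_ge0_le0 ?exprn_ge0 ?(ltW (lt_trans a0 ax))//.
    by have := hc _ ax; rewrite ce; lra.
  rewrite ![- (2 * e) * _]mulNr !opprK => /le_trans/(_ (ler_norm _)) le_D.
  have [g0|g0] := leP 0 (f1 s + 2 * e * (2 * s)); last first.
    exact: (le_trans (ltW g0) (normr_ge0 _)).
  by apply: le_trans le_D; rewrite ler_peMl// exprn_ege1.
pose F r := f r + 2 * e * r ^+ 2 - D * r.
have FE r : s0 <= r -> F r <= F s0.
  move=> s0r.
  apply: (@der_le0_nincr _ F (fun r => f1 r + 2 * e * (2 * r) - D)) => //.
    move=> x xs; rewrite /F; apply: derB.
      apply: derD; first by have [] : _ /\ _ := fh (r + 1) x ltac:(rewrite /s0 in xs; lra).
      by apply: derZ; apply: (der_eq _ (derXn x 2)); rewrite expr1.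
    by apply: (der_eq _ (derZ D (der_id x))); rewrite mulr1.
  by move=> x xs; rewrite subr_le0 f1D//; lra.
have [r1 r11 H] := quadratic_dominates D (F s0) e0.
exists e, (Num.max r1 s0); split=> //; first by rewrite le_max r11.
move=> r; rewrite ge_max => /andP[/H Hr /FE]; rewrite {1}/F; lra.
Qed.

End radial_laplace_equation.

(** * The sign alternative and quadratic decay *)

Section sign_alternative.
Context {R : realType} (N : nat).
Implicit Types v : nat -> R -> R.

(** At each level the quadratic bound is weakened to a constant on [r >= r1 >= 1] before the next
    integration; only the last integration keeps [r^2], whence [0 < j]. *)
Lemma radlap_chain_decay v (v1 : nat -> R -> R) (j : nat) (a c : R) :
  (0 < j)%N -> 0 < a -> 0 < c ->
  (forall i, (i < j)%N -> forall b, radlap_eq N 0 b (v i) (v1 i) (v i.+1)) ->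
  (forall r, a < r -> v j r <= - c) ->
  exists e r1, [/\ 0 < e, 1 <= r1 & forall r, r1 <= r -> v 0%N r <= - e * r ^+ 2].
Proof.
elim: j a c => // j IH a c _ a0 c0 H vj.
have Hj b : radlap_eq N a b (v j) (v1 j) (v j.+1).
  exact: (radlap_eq_sub (ltW a0) (lexx b) (H j (ltnSn j) b)).
have [e [r1 [e0 r11 vj']]] := radlap_decay a0 c0 Hj vj.
case: j IH H Hj vj vj' => [|j] IH H Hj vj vj'; first by exists e, r1.
apply: (IH r1 e) => //; first by rewrite (lt_le_trans _ r11).
  by move=> i ij b; apply: H; rewrite ltnS ltnW.
move=> r /ltW rr; apply: (le_trans (vj' _ rr)).
have r1' : 1 <= r := le_trans r11 rr.
by rewrite mulNr lerN2 ler_peMr ?exprn_ege1// ltW.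
Qed.

(* Going down from [(-Delta)^m u = exp u > 0], each [(-Delta)^k u] is
   decreasing as long as the previous one stays positive. *)
Lemma sign_alternative v (v1 : nat -> R -> R) (m k : nat) :
  (forall i, (i < m)%N -> forall b, radlap_eq N 0 b (v i) (v1 i) (v i.+1)) ->
  (forall i, (i < m)%N -> v i x @[x --> 0^'+] --> v i 0) ->
  (forall i, (i < m)%N -> v1 i x @[x --> 0^'+] --> 0) ->
  (forall r, 0 < r -> 0 < (-1) ^+ m * v m r) ->
  (k < m)%N -> Num.sg (v k 0) != (-1) ^+ k ->
  exists j a c, [/\ (k <= j < m)%N, 0 < a, 0 < c &
    forall r, a < r -> (-1) ^+ j * v j r <= - c].
Proof.
move=> H v0 v10 vm km sk.
pose w i r := (-1) ^+ i * v i r.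
have decr i : (i < m)%N -> (forall r, 0 < r -> 0 < w i.+1 r) ->
    (forall r, 0 < r -> w i r < w i 0) /\ (forall r s, 0 < r < s -> w i s < w i r).
  move=> im wpos.
  suff D b : (forall r, 0 < r < b -> w i r < w i 0) /\
      (forall r s, 0 < r < s -> s < b -> w i s < w i r).
    by split=> [r r0|r s rs]; [apply: (D (r + 1)).1; lra|apply: (D (s + 1)).2 => //; lra].
  apply: (radlap_decr (radlap_eqZ ((-1) ^+ i) (H i im b))).
  - by apply: cvgM; [exact: cvg_cst|exact: v0].
  - by rewrite -[X in _ --> X](mulr0 ((-1) ^+ i)); apply: cvgM; [exact: cvg_cst|exact: v10].
  - by move=> r /andP[/wpos]; rewrite /w exprS mulN1r mulNr oppr_gt0.
(* Strict decrease turns [w i r0 <= 0] into a negative value at [r0 + 1], which bounds all later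
   values. *)
have late i r0 : (i < m)%N -> (forall r, 0 < r -> 0 < w i.+1 r) -> 0 < r0 ->
    w i r0 <= 0 -> exists a c, [/\ 0 < a, 0 < c & forall r, a < r -> w i r <= - c].
  move=> im /(decr i im)[_ D] r00 wr0; exists (r0 + 1), (- w i (r0 + 1)); split.
  - lra.
  - rewrite oppr_gt0; apply: (lt_le_trans _ wr0); apply: D; lra.
  - by move=> r rr; rewrite opprK ltW//; apply: D; lra.
(* The descent from [m] stops at [k.+1]. At [k] itself the failing sign means [w k 0 <= 0], so if
   [w k.+1] is positive then [w k] is negative on all positive radii. *)
suff [wpos|] : (forall r, 0 < r -> 0 < w k.+1 r) \/
  exists j a c, [/\ (k.+1 <= j < m)%N, 0 < a, 0 < c & forall r, a < r -> w j r <= - c].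
- have wk0 : w k 0 <= 0.
    rewrite leNgt; apply/negP => wk0; move/negP: sk; apply.
    move: wk0; rewrite /w -signr_odd; case: (odd k) => /=.
      by rewrite expr1 mulN1r oppr_gt0 => /ltr0_sg ->.
    by rewrite expr0 mul1r => /gtr0_sg ->.
  have w1 : w k 1 <= 0 by apply: le_trans wk0; rewrite ltW//; apply: (decr k km wpos).1.
  have [a [c [a0 c0 ac]]] := late k 1 km wpos ltr01 w1.
  by exists k, a, c; rewrite leqnn km.
- move=> [j [a [c [/andP[kj jm] a0 c0 ac]]]].
  by exists j, a, c; rewrite (ltnW kj) jm.
rewrite -(subKn km).
elim: (m - k.+1)%N => [|d IH]; first by left => r r0; rewrite subn0; exact: vm.
(* For [d >= m] truncated subtraction leaves the index at 0, and the induction hypothesis is already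
   the claim. *)
have [dm|md] := ltnP d m; last first.
  have -> : (m - d.+1 = m - d)%N.
    by rewrite (eqP (md : m - d == 0)%N); apply/eqP; rewrite subn_eq0 leqW.
  exact: IH.
rewrite -(subnSK dm) in IH.
have im' : (m - d.+1 < m)%N by rewrite ltn_subrL (leq_ltn_trans _ dm).
case: IH => [wpos|[j [a [c [/andP[ij jm] a0 c0 ac]]]]]; last first.
  by right; exists j, a, c; rewrite (ltnW ij) jm.
have [wp|/existsNP[r0 /not_implyP[r00 /negP]]] :=
    pselect (forall r, 0 < r -> 0 < w (m - d.+1)%N r); first by left.
rewrite -leNgt => /(late _ _ im' wpos r00)[a [c [a0 c0 ac]]].
by right; exists (m - d.+1)%N, a, c; rewrite leqnn im'.
Qed.

Lemma radial_solution_decay v (v1 : nat -> R -> R) (m k : nat) : odd m ->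
  (forall i, (i < m)%N -> forall b, radlap_eq N 0 b (v i) (v1 i) (v i.+1)) ->
  (forall i, (i < m)%N -> v i x @[x --> 0^'+] --> v i 0) ->
  (forall i, (i < m)%N -> v1 i x @[x --> 0^'+] --> 0) ->
  (forall r, 0 < r -> v m r = - expR (v 0%N r)) ->
  (1 <= k < m)%N -> Num.sg (v k 0) != (-1) ^+ k ->
  exists e r1, [/\ 0 < e, 1 <= r1 & forall r, r1 <= r -> v 0%N r <= - e * r ^+ 2].
Proof.
move=> mo H v0 v10 vm /andP[k1 km] sk.
have [|j [a [c [/andP[kj jm] a0 c0 ac]]]] := sign_alternative H v0 v10 _ km sk.
  by move=> r r0; rewrite vm// -signr_odd mo expr1 mulrNN mul1r expR_gt0.
(* The condition [1 <= k] enters here: at [j = 0] the bound [u <= - c] would carry no quadratic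
   decay. *)
have j0 : (0 < j)%N by rewrite (leq_trans k1).
have Hj i : (i < j)%N -> forall b, radlap_eq N 0 b (v i) (v1 i) (v i.+1).
  by move=> ij; apply: H; rewrite (ltn_trans ij).
move: ac; rewrite -signr_odd; case: (odd j) => /= ac; last first.
  apply: (radlap_chain_decay j0 a0 c0 Hj) => r ar.
  by have := ac r ar; rewrite expr0 mul1r.
have [||e [r1 [e0 r11 v0N]]] := @radlap_chain_decay (fun i r => - v i r)
    (fun i r => - v1 i r) j a c j0 a0 c0.
- by move=> i ij b; apply: radlap_eqN; exact: Hj.
- by move=> r ar; have := ac r ar; rewrite expr1 mulN1r.
have r10 : 0 < r1 := lt_le_trans ltr01 r11.
have v0pos r : r1 <= r -> 0 <= v 0%N r.
  move=> rr; have := v0N r rr; rewrite mulNr lerN2; apply: le_trans.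
  by rewrite mulr_ge0 ?sqr_ge0// ltW.
(* Beyond [r1], [u >= 0] gives [v m <= - exp 0 = - 1]; the chain restarts from index [m] with
   [c = 1] and makes [u] negative far out. *)
have [||e' [r2 [e'0 r21 v0D]]] := @radlap_chain_decay v v1 m r1 1 _ r10 ltr01 H.
- by case: (m) mo.
- move=> r rr; rewrite vm ?(lt_trans r10)// lerN2 -expR0 ler_expR.
  by apply: v0pos; exact: ltW.
pose r := Num.max r1 r2.
have := v0D r; rewrite le_max lexx orbT => /(_ isT).
rewrite leNgt => /negP; case; rewrite (@lt_le_trans _ _ 0)//.
  by rewrite mulNr oppr_lt0 mulr_gt0// exprn_gt0// lt_max r10.
by apply: v0pos; rewrite le_max lexx.
Qed.

End sign_alternative.

(** * Picard iteration *)

Section primitives.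
Context {R : realType}.
Implicit Types (f : R -> R) (a c : R).

Lemma primitive_right f c : continuous f ->
  exists F : R -> R, forall x, c < x -> is_derive x 1 F (f x).
Proof.
move=> cf; exists (fun x => \int[lebesgue_measure]_(t in `[c, x]) f t)%R => x cx.
have [|//|//||dF <-] := @continuous_FTC1_closed R f c x (x + 1).
- by rewrite ltrDl.
- apply: continuous_compact_integrable; first exact: segment_compact.
  exact: continuous_subspaceT.
- exact: cf.
- by rewrite derive1E; exact/derivableP.
Qed.

(** An integral from a base point is a primitive only to the right of it. Reflection gives a second
    primitive to the left of [a + 1]; normalised at [a], the two agree on the overlap
    [(a - 1, a + 1)] because their difference has derivative zero. *)
Lemma primitive_exists f a : continuous f ->
  exists2 F : R -> R, F a = 0 & forall x : R, is_derive x 1 F (f x).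
Proof.
move=> cf; have [F1 dF1] := @primitive_right f (a - 1) cf.
have cf' : continuous (fun x => f (- x)).
  by move=> x; apply: continuous_comp; [exact: opp_continuous|exact: cf].
have [F2 dF2] := @primitive_right _ (- (a + 1)) cf'.
pose G x := - F2 (- x).
have dG x : x < a + 1 -> is_derive x 1 G (f x).
  move=> xa; have : is_derive (- x) 1 F2 (f (- - x)) by apply: dF2; rewrite ltrN2.
  rewrite opprK => dF; have := derN (der_comp (derN (der_id x)) dF).
  by apply: der_eq; rewrite mulrN1 opprK.
have FG x : a - 1 < x < a + 1 -> F1 x - F1 a = G x - G a.
  move=> xa; apply/eqP; rewrite -subr_eq0; apply/eqP.
  have dD y : a - 1 < y < a + 1 -> is_derive y 1 (fun x => F1 x - G x) 0.
    move=> /andP[ay ya]; apply: (der_eq _ (derB (dF1 _ ay) (dG _ ya))); exact: subrr.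
  have [xa'|ax|->] := ltgtP x a; last by rewrite !subrr.
  - have [|c _] := @mean_value _ (fun x => F1 x - G x) (fun=> 0) x a xa'.
      by move=> y /andP[? ?]; apply: dD; lra.
    lra.
  - have [|c _] := @mean_value _ (fun x => F1 x - G x) (fun=> 0) a x ax.
      by move=> y /andP[? ?]; apply: dD; lra.
    lra.
exists (fun x => if x < a then G x - G a else F1 x - F1 a); first by rewrite ltxx subrr.
have d1 x : a - 1 < x -> is_derive x 1 (fun x => F1 x - F1 a) (f x).
  move=> ax; apply: (der_eq _ (derB (dF1 _ ax) (der_cst _ _ _))); exact: subr0.
have d2 x : x < a + 1 -> is_derive x 1 (fun x => G x - G a) (f x).
  move=> ax; apply: (der_eq _ (derB (dG _ ax) (der_cst _ _ _))); exact: subr0.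
move=> x; have [xa|ax] := ltP x a.
- apply: der_near (d2 x _); last by lra.
  by near=> y; rewrite ifT//; near: y; exact: lt_nbhsl.
- apply: der_near (d1 x _); last by lra.
  near=> y; case: ifPn => // ya; apply: FG; rewrite (lt_trans ya) ?ltrDl// andbT.
  by near: y; apply: lt_nbhsr; lra.
Unshelve. all: by end_near. Qed.

End primitives.

Section picard.
Context {R : realType} (N : nat) (a : R) (a0 : 0 < a).
Implicit Types (f g h : R -> R).

Lemma continuous_maxl (c : R) f : continuous f -> continuous (fun t => f (Num.max t c)).
Proof.
move=> cf t; apply: (@continuous_comp _ _ _ (fun t => Num.max t c) f); last exact: cf.
by apply: continuous_max; [exact: cvg_id|exact: cvg_cst].
Qed.

Lemma radlap_solve h (A A1 : R) : continuous h ->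
  exists f f1, [/\ continuous f, f a = A, f1 a = A1 &
    forall b, radlap_eq N (a / 2) b f f1 h].
Proof.
(* Freezing the weight to the left of [a / 2] makes it continuous and nonzero on the whole line, so
   global primitives can be divided by it. *)
move=> ch; pose p (t : R) := Num.max t (a / 2) ^+ N.
have cp : continuous p.
  by apply: (@continuous_maxl _ (fun s => s ^+ N)); exact: exprn_continuous.
have p0 t : p t != 0 by rewrite expf_neq0// gt_eqF// lt_max divr_gt0 ?orbT.
have cph : continuous (fun t => p t * h t).
  by move=> t; apply: for_continuousM; [exact: cp|exact: ch].
have [F Fa dF] := primitive_exists a cph.
pose f1 t := (a ^+ N * A1 + F t) / p t.
have cf1 : continuous f1.
  move=> t; apply: (@for_continuousM _ _ (fun t => _ + F t) (fun t => (p t)^-1));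
    last by apply: for_continuousV => //; exact: cp.
  apply: for_continuousD; first exact: for_continuous_cst.
  exact: (der_continuous (dF t)).
have [G Ga dG] := primitive_exists a cf1.
have pE t : a / 2 < t -> p t = t ^+ N by move=> at_; rewrite /p max_l// ltW.
exists (fun t => A + G t), f1; split.
- move=> t; apply: for_continuousD; first exact: for_continuous_cst.
  exact: (der_continuous (dG t)).
- by rewrite Ga addr0.
- rewrite /f1 Fa addr0 pE; last by rewrite ltr_pdivrMr// ltr_pMr// ltr1n.
  by rewrite mulrAC divff ?mul1r// expf_neq0// gt_eqF.
- move=> b t /andP[at_ _]; have t0 : 0 < t by apply: lt_trans at_; rewrite divr_gt0.
  split.
    by apply: (der_eq _ (derD (der_cst _ _ A) (dG t))); rewrite add0r.
  apply: (@der_near _ (fun s => a ^+ N * A1 + F s)).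
    near=> s; rewrite /f1 pE; last by near: s; exact: lt_nbhsr.
    rewrite [RHS]mulrC divfK// expf_neq0// gt_eqF//; near: s; exact: lt_nbhsr.
  by rewrite -(pE t)//; apply: (der_eq _ (derD (der_cst _ _ _) (dF t))); rewrite add0r.
Unshelve. all: by end_near. Qed.

Lemma radlap_solve_chain (m : nat) (A A1 : nat -> R) h : continuous h ->
  exists w w1, [/\ forall i, (i <= m)%N -> continuous (w i), w m = h,
    forall i, (i < m)%N -> w i a = A i /\ w1 i a = A1 i &
    forall i, (i < m)%N -> forall b, radlap_eq N (a / 2) b (w i) (w1 i) (w i.+1)].
Proof.
elim: m h => [|m IH] h ch.
  by exists (fun=> h), (fun=> h); split=> // i.
have [f [f1 [cf fA f1A fh]]] := radlap_solve (A m) (A1 m) ch.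
have [w [w1 [cw wm wA wr]]] := IH f cf.
exists (fun i => if (i <= m)%N then w i else h), (fun i => if (i < m)%N then w1 i else f1).
split.
- by move=> i; case: ifPn => // im _; exact: cw.
- by rewrite ltnn.
- move=> i; rewrite ltnS => im; rewrite im; move: im.
  by rewrite leq_eqVlt => /predU1P[->|im]; [rewrite ltnn wm|rewrite im; exact: wA].
- move=> i; rewrite ltnS => im; rewrite im; move: im.
  rewrite leq_eqVlt => /predU1P[->|im]; first by rewrite ltnn wm.
  by rewrite im; exact: wr.
Qed.

Variables (lam : R) (lam1 : 1 <= lam).
Let lam0 : 0 < lam. Proof. exact: lt_le_trans lam1. Qed.
(** The weight of Bielecki's norm: integrating it gains a factor [1 / lam], so Picard's map
    contracts on intervals of any length. *)
Let E t := expR (lam * (t - a)).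

Let dE (K t : R) : is_derive t 1 (fun t => K / lam * E t) (K * E t).
Proof.
apply: (der_eq _ (derZ _ (der_comp (derZ lam (derB (der_id t) (der_cst t 1 a)))
  (is_derive_expR _)))).
by rewrite subr0 mulr1 /E; field; rewrite gt_eqF.
Qed.

Let Ea : E a = 1. Proof. by rewrite /E subrr mulr0 expR0. Qed.

(** Each of the two integrations gains [1 / lam]. As [lam >= 1], one of the two factors is
    dropped. *)
Lemma radlap_upper_bound a' b f f1 h (C : R) : a' < a -> 0 <= C ->
  radlap_eq N a' b f f1 h -> f a = 0 -> f1 a = 0 ->
  (forall t, a <= t < b -> h t <= C * E t) ->
  forall t, a <= t < b -> f t <= C / lam * E t.
Proof.
move=> aa C0 fh fa f1a hC.
have f1C s : a <= s < b -> f1 s <= C / lam * E s.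
  move=> /andP[as_ sb]; have sN : 0 < s ^+ N by rewrite exprn_gt0// (lt_le_trans a0).
  have : s ^+ N * f1 s - s ^+ N * (C / lam * E s) <=
         a ^+ N * f1 a - s ^+ N * (C / lam * E a).
    (* The comparison term carries the weight frozen at the right endpoint [s], so that
       [x ^+ N <= s ^+ N] controls the derivative. *)
    apply: (@der_le0_nincr _ (fun t => t ^+ N * f1 t - s ^+ N * (C / lam * E t))
      (fun t => t ^+ N * h t - s ^+ N * (C * E t))) => //.
      move=> x /andP[ax xs]; apply: derB; last by apply: derZ; exact: dE.
      by have [] : _ /\ _ := fh x ltac:(lra).
    move=> x /andP[ax xs]; rewrite subr_le0.
    have xN : 0 <= x ^+ N by rewrite exprn_ge0// ltW// (lt_trans a0).
    apply: (@le_trans _ _ (x ^+ N * (C * E x))).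
      by apply: ler_wpM2l => //; apply: hC; lra.
    apply: ler_wpM2r; first by rewrite mulr_ge0// expR_ge0.
    have x0 : 0 < x := lt_trans a0 ax.
    by apply: lerXn2r; rewrite ?nnegrE ltW// (lt_trans x0).
  rewrite f1a mulr0 sub0r -mulrBr => H.
  have : s ^+ N * (f1 s - C / lam * E s) <= 0.
    by rewrite (le_trans H)// oppr_le0 Ea mulr1 mulr_ge0// ?divr_ge0// ltW.
  by rewrite pmulr_rle0// subr_le0.
move=> t /andP[at_ tb].
have : f t - C / lam / lam * E t <= f a - C / lam / lam * E a.
  apply: (@der_le0_nincr _ (fun t => f t - C / lam / lam * E t)
    (fun t => f1 t - C / lam * E t)) => //.
    move=> x /andP[ax xt]; apply: derB; last exact: dE.
    by have [] : _ /\ _ := fh x ltac:(lra).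
  by move=> x /andP[ax xt]; rewrite subr_le0; apply: f1C; lra.
have C1 : 0 <= C / lam by rewrite divr_ge0// ltW.
have C2 : 0 <= C / lam / lam by rewrite divr_ge0// ltW.
have C3 : C / lam / lam * E t <= C / lam * E t.
  by apply: ler_wpM2r; [exact: expR_ge0|rewrite ler_pdivrMr// ler_peMr].
rewrite fa Ea; lra.
Qed.

Lemma radlap_abs_bound a' b f f1 h (C : R) : a' < a -> 0 <= C ->
  radlap_eq N a' b f f1 h -> f a = 0 -> f1 a = 0 ->
  (forall t, a <= t < b -> `|h t| <= C * E t) ->
  forall t, a <= t < b -> `|f t| <= C / lam * E t.
Proof.
move=> aa C0 fh fa f1a hC t tb; rewrite ler_norml lerNl; apply/andP; split.
  apply: (radlap_upper_bound aa C0 (radlap_eqN fh)) => //; rewrite ?fa ?f1a ?oppr0//.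
  by move=> s /hC; rewrite ler_norml lerNl => /andP[].
apply: (radlap_upper_bound aa C0 fh) => //.
by move=> s /hC; rewrite ler_norml => /andP[].
Qed.

Lemma radlap_chain_bound a' b (m : nat) (w w1 z z1 : nat -> R -> R) (C : R) :
  (0 < m)%N -> a' < a -> 0 <= C ->
  (forall i, (i < m)%N -> radlap_eq N a' b (w i) (w1 i) (w i.+1)) ->
  (forall i, (i < m)%N -> radlap_eq N a' b (z i) (z1 i) (z i.+1)) ->
  (forall i, (i < m)%N -> w i a = z i a /\ w1 i a = z1 i a) ->
  (forall t, a <= t < b -> `|w m t - z m t| <= C * E t) ->
  forall t, a <= t < b -> `|w 0%N t - z 0%N t| <= C / lam * E t.
Proof.
move=> m0 aa C0; elim: m m0 => // m IH _ H1 H2 H3 H4.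
have [e1 e2] := H3 m (ltnSn m).
have Hm t : a <= t < b -> `|w m t - z m t| <= C / lam * E t.
  apply: (radlap_abs_bound aa C0 (radlap_eqB (H1 m (ltnSn m)) (H2 m (ltnSn m)))) => //.
    by rewrite e1 subrr.
  by rewrite e2 subrr.
case: m IH H1 H2 H3 H4 Hm {e1 e2} => [//|m] IH H1 H2 H3 H4 Hm.
apply: IH => // [i im|i im|i im|t tb].
- by apply: H1; rewrite ltnS ltnW.
- by apply: H2; rewrite ltnS ltnW.
- by apply: H3; rewrite ltnS ltnW.
- apply: (le_trans (Hm t tb)); apply: ler_wpM2r; first exact: expR_ge0.
  by rewrite ler_pdivrMr// ler_peMr.
Qed.

End picard.

(** The radius [d j] is the sum of all remaining steps, so the intervals of radius [d j] around
    [x j] are nested, and the supremum of their left endpoints lies in all of them. The explicit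
    rate later yields continuity of the limit. *)
Lemma geometric_limit {R : realType} (x : nat -> R) (K : R) :
  (forall j, `|x j.+1 - x j| <= K / 2 ^+ j) ->
  exists l, forall j, `|x j - l| <= 2 * K / 2 ^+ j.
Proof.
move=> xK.
have K0 : 0 <= K by have := le_trans (normr_ge0 _) (xK 0%N); rewrite expr0 divr1.
pose d j : R := 2 * K / 2 ^+ j.
have dS j : d j = K / 2 ^+ j + d j.+1.
  by rewrite /d exprS; field; rewrite expf_neq0.
have d0 j : 0 <= d j by rewrite /d divr_ge0 ?mulr_ge0 ?exprn_ge0.
have step j : x j - d j <= x j.+1 - d j.+1 /\ x j.+1 + d j.+1 <= x j + d j.
  by have := xK j; rewrite dS ler_norml => /andP[? ?]; split; lra.
have mono j i : x j - d j <= x (j + i)%N - d (j + i)%N /\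
    x (j + i)%N + d (j + i)%N <= x j + d j.
  elim: i => [|i [IH1 IH2]]; first by rewrite addn0.
  rewrite addnS; have [s1 s2] := step (j + i)%N.
  by split; [exact: le_trans s1|exact: le_trans IH2].
have cross i j : x i - d i <= x j + d j.
  have := (mono i j).1; have := (mono j i).2; rewrite (addnC j i).
  have := d0 (i + j)%N; lra.
pose A := [set x j - d j | j in setT].
exists (sup A) => j; rewrite -/(d j) ler_distl; apply/andP; split.
  by rewrite lerBlDr; apply: ge_sup => [|_ [i _ <-]//]; exists (x 0%N - d 0%N), 0%N.
rewrite -lerBlDr; apply: ub_le_sup; last by exists j.
by exists (x 0%N + d 0%N) => _ [i _ <-].
Qed.

Lemma small_all_eq0 {R : realType} (x K : R) : (forall j, x <= K / 2 ^+ j) -> x <= 0.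
Proof.
move=> xK; rewrite leNgt; apply/negP => x0.
pose j := Num.truncn (K / x).
have : K / x < 2 ^+ j.
  apply: (lt_le_trans (truncnS_gt _)).
  by rewrite -natrX ler_nat ltn_expl.
rewrite ltr_pdivrMr// => Kx; have := xK j.
by rewrite ler_pdivlMr ?exprn_gt0// leNgt mulrC Kx.
Qed.

Section global_picard.
Context {R : realType} (N m : nat) (a L B : R) (g : R -> R).
Hypotheses (m0 : (0 < m)%N) (a0 : 0 < a) (L0 : 0 <= L).
Hypotheses (g_lip : forall x y, `|g x - g y| <= L * `|x - y|)
  (g_bound : forall x, `|g x| <= B).

(** Gives [L / lam <= 1 / 2], so that each Picard step halves the weighted distance, and also
    [lam >= 1]. *)
Let lam := 1 + 2 * L.
Let lam1 : 1 <= lam. Proof. by rewrite /lam lerDl mulr_ge0. Qed.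
Let lam0 : 0 < lam. Proof. exact: lt_le_trans lam1. Qed.
Let E t := expR (lam * (t - a)).
Let aa : a / 2 < a. Proof. by rewrite ltr_pdivrMr// ltr_pMr// ltr1n. Qed.

Let Llam C : 0 <= C -> L * C / lam <= C / 2.
Proof.
move=> C0; rewrite ler_pdivrMr// mulrAC ler_pdivlMr// /lam.
nra.
Qed.

Lemma lipschitz_continuous f : continuous f -> continuous (fun t : R => g (f t)).
Proof.
move=> cf t; apply: (@for_continuous_comp _ _ g f); first exact: cf.
apply/cvgrPdist_lt => e e0; have e1 : 0 < e / (L + 1) by rewrite divr_gt0// ltr_wpDl.
near=> y; apply: (le_lt_trans (g_lip _ _)).
have : `|f t - y| < e / (L + 1).
  by near: y; move/cvgrPdist_lt : (@cvg_id _ (nbhs (f t))) => /(_ _ e1).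
rewrite ltr_pdivlMr ?ltr_wpDl//; apply: le_lt_trans.
by rewrite mulrDr mulr1 mulrC lerDl.
Unshelve. all: by end_near. Qed.

Lemma picard_unique (a' b : R) (v v1 w w1 : nat -> R -> R) : a' < a ->
  (forall i, (i < m)%N -> radlap_eq N a' b (v i) (v1 i) (v i.+1)) ->
  (forall i, (i < m)%N -> radlap_eq N a' b (w i) (w1 i) (w i.+1)) ->
  (forall i, (i < m)%N -> v i a = w i a /\ v1 i a = w1 i a) ->
  (forall t, a <= t < b -> v m t = g (v 0%N t)) ->
  (forall t, a <= t < b -> w m t = g (w 0%N t)) ->
  forall t, a <= t < b -> v 0%N t = w 0%N t.
Proof.
move=> a'a Hv Hw data vm wm t /andP[at_ tb].
(* The difference may be unbounded near [b]; on [[a, c]] it has a maximum [K], from which the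
   halving starts. *)
pose c := (t + b) / 2; have [tc cb] : t < c /\ c < b by rewrite /c; lra.
have cont : {within `[a, c], continuous (fun t => `|v 0%N t - w 0%N t|)}.
  apply: continuous_in_subspaceT => y /[!inE]/=; rewrite in_itv/= => /andP[ay yc].
  have yab : a' < y < b by rewrite (lt_le_trans a'a ay) (le_lt_trans yc cb).
  apply: (@for_continuous_comp _ _ (fun x : R => `|x|) (fun t => v 0%N t - w 0%N t));
    last exact: norm_continuous.
  apply: (for_continuousD _ (for_continuousN _)).
    exact: (der_continuous (Hv 0%N m0 y yab).1).
  exact: (der_continuous (Hw 0%N m0 y yab).1).
have ac : a <= c by rewrite (le_trans at_)// ltW.
have [y _ yM] := EVT_max ac cont; set K := `|_| in yM.
have K0 : 0 <= K by exact: normr_ge0.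
have step j : forall s, a <= s < c -> `|v 0%N s - w 0%N s| <= K / 2 ^+ j * E s.
  elim: j => [|j IH] s sc.
    rewrite expr0 divr1; apply: (@le_trans _ _ K).
      by apply: yM; rewrite in_itv/=; case/andP: sc => -> /ltW.
    rewrite ler_peMr// -expR0 ler_expR mulr_ge0//; first exact: ltW.
    by rewrite subr_ge0; case/andP: sc.
  have Kj0 : 0 <= K / 2 ^+ j by rewrite divr_ge0// exprn_ge0.
  have := @radlap_chain_bound _ N a a0 lam lam1 a' c m v v1 w w1 (L * (K / 2 ^+ j))
    m0 a'a (mulr_ge0 L0 Kj0).
  move=> /(_ _ _ _ _ s sc) H; apply: (le_trans (H _ _ _ _)).
  - by move=> i im; apply: radlap_eq_sub (Hv i im) => //; exact: ltW.
  - by move=> i im; apply: radlap_eq_sub (Hw i im) => //; exact: ltW.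
  - exact: data.
  - move=> x /andP[ax xc]; have xb : a <= x < b by rewrite ax (lt_trans xc).
    rewrite vm// wm// (le_trans (g_lip _ _))// -mulrA ler_wpM2l// IH//.
    by rewrite ax.
  - apply: ler_wpM2r; first exact: expR_ge0.
    by apply: (le_trans (Llam Kj0)); rewrite exprSr invfM mulrA.
apply/eqP; rewrite -subr_eq0 -normr_le0.
have := @small_all_eq0 _ (`|v 0%N t - w 0%N t|) (K * E t); apply => j.
by rewrite mulrAC; apply: step; rewrite at_.
Qed.

Lemma picard_exists (A A1 : nat -> R) :
  exists w w1 : nat -> R -> R, [/\ forall i, (i <= m)%N -> continuous (w i),
    forall i, (i < m)%N -> w i a = A i /\ w1 i a = A1 i,
    forall i, (i < m)%N -> forall b, radlap_eq N (a / 2) b (w i) (w1 i) (w i.+1) &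
    forall t, a <= t -> w m t = g (w 0%N t)].
Proof.
(* Choice makes the linear solution operator a function of the right-hand side, with arbitrary
   values at discontinuous ones. *)
have /choice[sol solP] : forall h : R -> R, exists p : (nat -> R -> R) * (nat -> R -> R),
    continuous h -> [/\ forall i, (i <= m)%N -> continuous (p.1 i), p.1 m = h,
    forall i, (i < m)%N -> p.1 i a = A i /\ p.2 i a = A1 i &
    forall i, (i < m)%N -> forall b, radlap_eq N (a / 2) b (p.1 i) (p.2 i) (p.1 i.+1)].
  move=> h; have [ch|] := pselect (continuous h); last by exists (fun=> h, fun=> h).
  by have [w [w1 W]] := @radlap_solve_chain _ N a a0 m A A1 h ch; exists (w, w1).
have B0 : 0 <= B := le_trans (normr_ge0 _) (g_bound 0).
have E0 t : 0 <= E t by exact: expR_ge0.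
have compare (h k : R -> R) (C t : R) : continuous h -> continuous k -> 0 <= C ->
    (forall s, a <= s -> `|h s - k s| <= C * E s) -> a <= t ->
    `|(sol h).1 0%N t - (sol k).1 0%N t| <= C / lam * E t.
  move=> /solP[_ hm hd hr] /solP[_ km kd kr] C0 hk at_.
  apply: (@radlap_chain_bound _ N a a0 lam lam1 (a / 2) (t + 1) m _ _ _ _ C m0 aa C0).
  - by move=> i im; exact: hr.
  - by move=> i im; exact: kr.
  - by move=> i im; have [-> ->] := hd i im; have [-> ->] := kd i im.
  - by move=> s /andP[as_ _]; rewrite hm km hk.
  - by rewrite at_/= ltrDl ltr01.
(* The estimates hold only from [a] on; composing with [max t a] discards the values to the left and
   keeps the right-hand side continuous on the line. *)
pose rhs (f : R -> R) t := g (f (Num.max t a)).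
have crhs f : continuous f -> continuous (rhs f).
  by move=> cf; apply: lipschitz_continuous; exact: continuous_maxl.
pose U := fix U j := if j is i.+1 then (sol (rhs (U i))).1 0%N
  else (sol (fun=> 0)).1 0%N.
have c0 : continuous (fun _ : R => 0 : R) by exact: cst_continuous.
have cU j : continuous (U j).
  elim: j => [|j IH] /=; first by have [+ _ _ _] := solP _ c0; apply.
  by have [+ _ _ _] := solP _ (crhs _ IH); apply.
have Ustep j t : a <= t -> `|U j.+1 t - U j t| <= B / 2 ^+ j * E t.
  elim: j t => [|j IH] t at_.
    rewrite expr0 divr1; apply: (@le_trans _ _ (B / lam * E t)).
      apply: compare => // [|s as_]; first exact: (crhs _ (cU 0%N)).
      rewrite subr0 (le_trans (g_bound _))// ler_peMr// -expR0 ler_expR.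
      by rewrite mulr_ge0 ?subr_ge0// ltW.
    by apply: ler_wpM2r => //; rewrite ler_pdivrMr// ler_peMr.
  have Bj : 0 <= B / 2 ^+ j by rewrite divr_ge0// exprn_ge0.
  apply: (@le_trans _ _ (L * (B / 2 ^+ j) / lam * E t)).
    apply: compare => // [||| s as_]; [exact: (crhs _ (cU j.+1))|exact: (crhs _ (cU j))|exact: mulr_ge0|].
    rewrite /rhs max_l// (le_trans (g_lip _ _))// -mulrA ler_wpM2l// distrC.
    by rewrite distrC IH.
  apply: ler_wpM2r => //; apply: (le_trans (Llam Bj)).
  by rewrite exprSr invfM mulrA.
have /choice[w wP] : forall t : R, exists l : R, a <= t ->
    forall j, `|U j t - l| <= 2 * (B * E t) / 2 ^+ j.
  move=> t; have [at_|ta] := leP a t; last by exists 0.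
  have [j|l lP] := @geometric_limit R (fun j => U j t) (B * E t).
    by rewrite mulrAC; exact: Ustep.
  by exists l.
pose w' t := w (Num.max t a).
have cw' : continuous w'.
  (* A three-epsilon argument: since [E] is increasing, its value at [tm] makes the rate of
     convergence uniform up to [t + 1]. *)
  move=> t; apply/cvgrPdist_lt => e e0.
  pose tm := Num.max (t + 1) a; pose K := 2 * (B * E tm).
  have [j Kj] : exists j, K / 2 ^+ j < e / 3.
    apply: contrapT => /forallNP H.
    have : e / 3 <= 0.
      by apply: (@small_all_eq0 _ _ K) => j; rewrite leNgt; apply/negP; exact: H.
    lra.
  have near_w s : s <= t + 1 -> `|U j (Num.max s a) - w' s| < e / 3.
    move=> st; apply: le_lt_trans Kj; apply: (le_trans (wP _ _ j)).
      by rewrite le_max lexx orbT.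
    rewrite ler_pM2r ?invr_gt0 ?exprn_gt0// /K ler_pM2l// ler_wpM2l// ler_expR.
    rewrite ler_pM2l// lerD2r /tm ge_max le_max st/=.
    by rewrite le_max lexx orbT.
  have cUm : continuous (fun s => U j (Num.max s a)) by exact: continuous_maxl.
  have e3 : 0 < e / 3 by lra.
  near=> s.
  have st : s <= t + 1 by near: s; apply: lt_le_nbhsl; rewrite ltrDl.
  have h1 := near_w t _; have h2 := near_w s st.
  have h3 : `|U j (Num.max t a) - U j (Num.max s a)| < e / 3.
    by near: s; move/cvgrPdist_lt : (cUm t) => /(_ _ e3).
  have {h1} := h1 ltac:(by rewrite lerDl); move: h2 h3.
  by rewrite !ltr_norml => /andP[? ?] /andP[? ?] /andP[? ?]; apply/andP; split; lra.
have ch : continuous (fun t => g (w' t)) by exact: lipschitz_continuous.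
have [cz zm zd zr] := solP _ ch.
(* The limit [w'] is only known to be continuous. The solution is its image under the solution
   operator, and comparison with [U j.+1] identifies the two from [a] on. *)
exists (sol (fun t => g (w' t))).1, (sol (fun t => g (w' t))).2; split=> // t at_.
rewrite zm; congr g; rewrite /w' max_l//.
apply/esym/eqP; rewrite -subr_eq0 -normr_le0.
apply: (@small_all_eq0 _ _ (2 * (B * E t))) => j.
have Bj : 0 <= 2 * B / 2 ^+ j by rewrite divr_ge0 ?mulr_ge0// exprn_ge0.
have h1 : `|(sol (fun t => g (w' t))).1 0%N t - U j.+1 t| <= L * (2 * B / 2 ^+ j) / lam * E t.
  apply: compare => // [||s as_]; [exact: (crhs _ (cU j))|exact: mulr_ge0|].
  rewrite /rhs /w' max_l// (le_trans (g_lip _ _))// -mulrA ler_wpM2l// distrC.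
  by apply: (le_trans (wP _ as_ j)); rewrite le_eqVlt; apply/orP; left; apply/eqP; ring.
have h2 := wP t at_ j.+1.
have h3 : L * (2 * B / 2 ^+ j) / lam * E t <= 2 * B / 2 ^+ j / 2 * E t.
  by apply: ler_wpM2r => //; exact: Llam.
apply: (le_trans (ler_distD (U j.+1 t) _ _)); apply: (le_trans (lerD (le_trans h1 h3) h2)).
rewrite le_eqVlt; apply/orP; left; apply/eqP; rewrite exprS; field.
by rewrite expf_neq0.
Unshelve. all: by end_near. Qed.

End global_picard.

Lemma truncated_exp_lipschitz {R : realType} (K x y : R) :
  `|- expR (Num.min x K) - - expR (Num.min y K)| <= expR K * `|x - y|.
Proof.
wlog xy : x y / x <= y.
  move=> H; have [|/ltW yx] := leP x y; first exact: H.
  by rewrite distrC (distrC x); exact: H.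
have mxy : Num.min x K <= Num.min y K by rewrite le_min !ge_min xy lexx orbT.
have d : Num.min y K - Num.min x K <= y - x.
  have [yK|Ky] := leP y K; first by rewrite min_l ?lexx// (le_trans xy).
  by have [xK|Kx] := leP x K; lra.
rewrite opprK addrC ger0_norm; last by rewrite subr_ge0 ler_expR.
rewrite (distrC x) (@ger0_norm _ (y - x)) ?subr_ge0//.
set p := Num.min x K in mxy d *; set q := Num.min y K in mxy d *.
(* After factoring, [1 - exp (p - q) <= q - p] gives the Lipschitz bound, and [q <= K] gives its
   constant. *)
have -> : expR q - expR p = expR q * (1 - expR (p - q)).
  by rewrite mulrBr mulr1 -expRD; congr (_ - expR _); ring.
have : 1 - expR (p - q) <= q - p by have := expR_ge1Dx (p - q); lra.
move=> /le_trans/(_ d) H.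
apply: (@le_trans _ _ (expR q * (y - x))).
  by apply: ler_wpM2l H; exact: expR_ge0.
by apply: ler_wpM2r; rewrite ?subr_ge0// ler_expR /q ge_min lexx orbT.
Qed.

(* The nonlinearity is truncated above the known upper bound [M] of the solution,
   which makes it bounded and globally Lipschitz; by continuity the truncation is
   still inactive slightly beyond [T]. *)
Lemma radial_solution_extends {R : realType} (N m : nat) (a T M : R)
    (v v1 : nat -> R -> R) : (0 < m)%N -> 0 < a < T ->
  (forall i, (i < m)%N -> radlap_eq N 0 T (v i) (v1 i) (v i.+1)) ->
  (forall t, a <= t < T -> v m t = - expR (v 0%N t)) ->
  (forall t, a <= t < T -> v 0%N t <= M) ->
  exists w w1 : nat -> R -> R, exists2 T', T < T' &
    [/\ forall i, (i <= m)%N -> continuous (w i),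
        forall i, (i < m)%N -> radlap_eq N (a / 2) T' (w i) (w1 i) (w i.+1),
        forall t, a <= t < T' -> w m t = - expR (w 0%N t) &
        forall t, a <= t < T -> w 0%N t = v 0%N t].
Proof.
move=> m0 /andP[a0 aT] Hv vm vM.
pose g (x : R) := - expR (Num.min x (M + 1)).
have g_bound x : `|g x| <= expR (M + 1).
  by rewrite normrN ger0_norm ?expR_ge0// ler_expR ge_min lexx orbT.
have [w [w1 [cw wd wr wm]]] := @picard_exists R N m a (expR (M + 1)) (expR (M + 1))
  g m0 a0 (expR_ge0 _) (truncated_exp_lipschitz (M + 1)) g_bound (v^~ a) (v1^~ a).
have a2 : 0 < a / 2 by rewrite divr_gt0.
have a2a : a / 2 < a by rewrite ltr_pdivrMr// ltr_pMr// ltr1n.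
have wv t : a <= t < T -> w 0%N t = v 0%N t.
  move=> tT.
  apply: (@picard_unique R N m a (expR (M + 1)) g m0 a0 (expR_ge0 _)
    (truncated_exp_lipschitz (M + 1)) (a / 2) T w w1 v v1) => //.
  - by move=> i im; exact: wr.
  - by move=> i im; apply: radlap_eq_sub (Hv i im) => //; exact: ltW.
  - by move=> s /andP[as_ _]; exact: wm.
  - move=> s sT; rewrite vm// /g min_l//; have := vM _ sT; lra.
have wT : w 0%N T <= M.
  have cT : w 0%N x @[x --> T^'-] --> w 0%N T.
    by apply: cvg_at_left_filter; exact: cw.
  apply: (cvgr_to_le cT); near=> t.
  have at_ : a <= t by near: t; exact: nbhs_left_ge.
  have tT : t < T by near: t; exact: nbhs_left_lt.
  by rewrite wv ?at_// vM ?at_.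
have [d d0 dw] : exists2 d, 0 < d & forall t, T <= t < T + d -> w 0%N t <= M + 1.
  have /cvgrPdist_lt/(_ _ ltr01) [d /= d0 dw] := cw 0%N isT T.
  exists d => // t /andP[Tt td].
  have : `|w 0%N T - w 0%N t| < 1.
    by apply: dw => /=; rewrite ler0_norm ?subr_le0//; lra.
  by rewrite ltr_norml => /andP[]; lra.
exists w, w1, (T + d); first by rewrite ltrDl.
split=> //; first by move=> i im; exact: wr.
move=> t /andP[at_ tT]; rewrite wm// /g min_l//.
have [tT'|Tt] := ltP t T; last by apply: dw; rewrite Tt.
have tT2 : a <= t < T by rewrite at_.
by rewrite wv//; have := vM _ tT2; lra.
Unshelve. all: by end_near. Qed.

(** * Radial functions on R^n *)

Section continuously_differentiable.
Context {R : realType} {V : normedModType R} {I : Type} (e : I -> V).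
Implicit Types (f g : V -> R) (O : set V) (k : nat).

(* With [e] a basis this is [C^k]; with the single direction 1 of the line it also
   covers profiles.  Unlike in [Ck], any function that is the derivative on [O] will
   do, so no extensionality of ['D_v f] is needed along the recursion. *)
Fixpoint Cdir k O f : Prop :=
  (forall x, O x -> {for x, continuous f}) /\
  if k is k'.+1 then forall i, exists2 g,
    forall x, O x -> is_derive x (e i) f (g x) & Cdir k' O g
  else True.

Lemma Cdir_eq k O f g : open O -> (forall x, O x -> f x = g x) ->
  Cdir k O f -> Cdir k O g.
Proof.
move=> oO fg; have nfg x : O x -> \forall y \near x, f y = g y.
  by move=> Ox; apply: filterS (open_nbhs_nbhs (conj oO Ox)).
case: k => [|k] [cf H]; split=> //.
- by move=> x Ox; apply: (for_continuous_near (nfg x Ox)); exact: cf.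
- by move=> x Ox; apply: (for_continuous_near (nfg x Ox)); exact: cf.
move=> i; have [d df Cd] := H i; exists d => // x Ox.
by apply: (near_eq_is_derive (nfg x Ox)); exact: df.
Qed.

Lemma CdirW k O f : Cdir k.+1 O f -> Cdir k O f.
Proof.
elim: k f => [|k IH] f [cf H]; split=> // i.
by have [g dg Cg] := H i; exists g => //; exact: IH.
Qed.

Lemma Cdir_cst k O (c : R) : Cdir k O (fun=> c).
Proof.
elim: k c => [|k IH] c; (split; first by move=> x _; exact: for_continuous_cst) => // i.
by exists (fun=> 0) => // x _; exact: der_cst.
Qed.

Lemma CdirD k O f g : Cdir k O f -> Cdir k O g -> Cdir k O (fun x => f x + g x).
Proof.
elim: k f g => [|k IH] f g [cf Hf] [cg Hg];
  (split; first by move=> x Ox; apply: for_continuousD; [exact: cf|exact: cg]) => // i.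
have [f' df Cf] := Hf i; have [g' dg Cg] := Hg i.
exists (fun x => f' x + g' x); last exact: IH.
by move=> x Ox; apply: derD; [exact: df|exact: dg].
Qed.

Lemma CdirM k O f g : Cdir k O f -> Cdir k O g -> Cdir k O (fun x => f x * g x).
Proof.
elim: k f g => [|k IH] f g Hf Hg.
  by split=> // x Ox; apply: for_continuousM; [exact: Hf.1|exact: Hg.1].
have Cf := CdirW Hf; have Cg := CdirW Hg; case: Hf Hg => [cf Hf] [cg Hg].
split=> [x Ox|i]; first by apply: for_continuousM; [exact: cf|exact: cg].
have [f' df Cf'] := Hf i; have [g' dg Cg'] := Hg i.
exists (fun x => f x * g' x + f' x * g x); last by apply: CdirD; exact: IH.
by move=> x Ox; apply: derM; [exact: df|exact: dg].
Qed.

Lemma CdirN k O f : Cdir k O f -> Cdir k O (fun x => - f x).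
Proof.
move=> Cf; rewrite (_ : (fun x => _) = (fun x => -1 * f x)).
  by apply: CdirM => //; exact: Cdir_cst.
by apply/funext => x; rewrite mulN1r.
Qed.

Lemma CdirX k O f j : Cdir k O f -> Cdir k O (fun x => f x ^+ j).
Proof.
move=> Cf; elim: j => [|j IH].
  by under eq_fun do rewrite expr0; exact: Cdir_cst.
by under eq_fun do rewrite exprS; exact: CdirM.
Qed.

Lemma Cdir_sum k O (J : Type) (s : seq J) (F : J -> V -> R) :
  (forall j, Cdir k O (F j)) -> Cdir k O (fun x => \sum_(j <- s) F j x).
Proof.
move=> CF; elim: s => [|j s IH].
  by under eq_fun do rewrite big_nil; exact: Cdir_cst.
by under eq_fun do rewrite big_cons; exact: CdirD.
Qed.

End continuously_differentiable.

Definition unit_direction {R : realType} (_ : unit) : R := 1.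

Notation Creal k a b f := (Cdir unit_direction k [set r | is_true (a < r < b)] f).

Section real_regularity.
Context {R : realType}.
Implicit Types (f h : R -> R) (a b : R).

Lemma open_oo a b : open [set r : R | a < r < b].
Proof.
rewrite (_ : [set r | _] = `]a, b[%classic); first exact: interval_open.
by apply/seteqP; split=> r /=; rewrite in_itv.
Qed.

Arguments open_oo : clear implicits.

Lemma Creal_inv k a b : 0 <= a -> Creal k a b (fun r => r^-1).
Proof.
move=> a0; have r0 r : a < r < b -> r != 0.
  by move=> /andP[ar _]; rewrite gt_eqF// (le_lt_trans a0).
elim: k => [|k IH]; (split; first by move=> r /r0; exact: inv_continuous) => // i.
exists (fun r => - (r^-1 * r^-1)); last by apply: CdirN; exact: CdirM.
move=> r /r0 rn0; apply: (der_eq _ (derV rn0 (der_id r))).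
by rewrite mulr1 expr2 invfM.
Qed.

Lemma Creal_id k a b : Creal k a b id.
Proof.
case: k => [|k]; (split; first by move=> r _; exact: cvg_id) => // i.
by exists (fun=> 1) => [r _|]; [exact: der_id|exact: Cdir_cst].
Qed.

Lemma radlap_eqP N a b f f1 h : 0 <= a -> radlap_eq N a b f f1 h <->
  forall r, a < r < b -> is_derive r 1 f (f1 r) /\
    is_derive r 1 f1 (h r - N%:R / r * f1 r).
Proof.
move=> a0; split=> H r rab; have [df dg] := H r rab; split=> //.
- have r0 : 0 < r by case/andP: rab => ar _; exact: le_lt_trans ar.
  have rn0 : r != 0 by rewrite gt_eqF.
  have := derM (derV (expf_neq0 N rn0 : (fun s => s ^+ N) r != 0) (derXn r N)) dg.
  rewrite /= => H'.
  apply: (@der_near _ (fun s => (s ^+ N)^-1 * (s ^+ N * f1 s))).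
    near=> s; rewrite mulKf// expf_neq0// gt_eqF//.
    by near: s; exact: lt_nbhsr.
  apply: (der_eq _ H').
  case: N {dg H H'} => [|N]; first by rewrite !expr0 /=; field; rewrite rn0.
  by rewrite !exprS /=; field; rewrite rn0 ?expf_neq0.
- have r0 : 0 < r by case/andP: rab => ar _; exact: le_lt_trans ar.
  have rn0 : r != 0 by rewrite gt_eqF.
  apply: (der_eq _ (derM (derXn r N) dg)).
  case: N {dg H} => [|N]; first by rewrite !expr0 /=; field; rewrite rn0.
  by rewrite !exprS /=; field; rewrite rn0.
Unshelve. all: by end_near. Qed.

(** The gain of two derivatives: the flux [r ^+ N * f1] has a [C^k] derivative by the divergence
    form, and division by [r ^+ N], smooth on positive radii, passes its regularity to [f1]. *)
Lemma radlap_Creal N k a b f f1 h : 0 <= a -> radlap_eq N a b f f1 h ->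
  Creal k a b h -> Creal k.+2 a b f.
Proof.
move=> a0 fh Ch.
have CXN j : Creal j a b (fun r => r ^+ N) by apply: (@CdirX _ _ _ _ _ _ id); exact: Creal_id.
have CF : Creal k.+1 a b (fun s => s ^+ N * f1 s).
  split=> [r /fh[_ dF]|i]; first exact: (der_continuous dF).
  exists (fun r => r ^+ N * h r); last by apply: CdirM => //; exact: CXN.
  by move=> r /fh[].
have Cf1 : Creal k.+1 a b f1.
  have E r : [set r | a < r < b] r -> r^-1 ^+ N * (r ^+ N * f1 r) = f1 r.
    move=> /= /andP[ar _].
    by rewrite exprVn mulKf// expf_neq0// gt_eqF// (le_lt_trans a0).
  exact: (Cdir_eq (open_oo a b) E (CdirM (CdirX N (Creal_inv k.+1 b a0)) CF)).
split=> [r /fh[df _]|i]; first exact: (der_continuous df).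
by exists f1 => // r /fh[].
Qed.

End real_regularity.
Arguments open_oo {R} a b.

Definition basis_vector {R : realType} {n : nat} (i : 'I_n) : 'rV[R]_n := delta_mx ord0 i.

Notation CRn k O f := (Cdir basis_vector k O f).

Section euclidean_norm.
Context {R : realType} {n : nat}.
Implicit Types (x : 'rV[R]_n) (f : 'rV[R]_n -> R) (O : set 'rV[R]_n).

Lemma Ck_Cdir k O f : Ck k O f -> CRn k O f.
Proof.
elim: k f => [|k IH] f [cf H]; split=> // i.
have [df Cf] := H i; exists (pderiv i f); last exact: IH.
by move=> x Ox; exact/derivableP/df.
Qed.

Lemma Cdir_Ck k O f : open O -> CRn k O f -> Ck k O f.
Proof.
move=> oO; elim: k f => [|k IH] f [cf H]; split=> // i.
have [g dg Cg] := H i; split; first by move=> x /dg[].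
apply: IH; apply: (Cdir_eq oO _ Cg) => x Ox.
by have [_ <-] := dg x Ox.
Qed.

Lemma Ck_pderiv k O f i : Ck k.+1 O f -> Ck k O (pderiv i f).
Proof. by move=> [_ /(_ i)[]]. Qed.

Lemma Ck_derive k O f i x : Ck k.+1 O f -> O x ->
  is_derive x (basis_vector i) f (pderiv i f x).
Proof. by move=> [_ /(_ i)[df _]] Ox; exact/derivableP/df. Qed.

Lemma Ck_continuous k O f x : Ck k O f -> O x -> {for x, continuous f}.
Proof. by case: k => [|k] [cf _]; exact: cf. Qed.

Lemma Ck_leq k k' O f : (k' <= k)%N -> Ck k O f -> Ck k' O f.
Proof.
elim: k k' f => [|k IH] [|k'] f //; first by move=> _ [].
rewrite ltnS => kk [cf H]; split=> // i.
by have [df Cf] := H i; split=> //; exact: IH Cf.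
Qed.

Lemma Ck_laplacian k O f : open O -> Ck k.+2 O f -> Ck k O (laplacian f).
Proof.
move=> oO Cf; apply: Cdir_Ck => //; apply: Cdir_sum => i.
by apply: Ck_Cdir; do 2 apply: Ck_pderiv.
Qed.

(** Used to glue a ball carrying the old solution to an annulus carrying its continuation. *)
Lemma Ck_union k O1 O2 f : Ck k O1 f -> Ck k O2 f -> Ck k (O1 `|` O2) f.
Proof.
elim: k f => [|k IH] f [c1 H1] [c2 H2]; (split; first by move=> x [/c1|/c2]) => // i.
have [d1 C1] := H1 i; have [d2 C2] := H2 i.
by split; [move=> x [/d1|/d2]|exact: IH].
Qed.

Lemma Ck_eq k O f g : open O -> (forall x, O x -> f x = g x) -> Ck k O f -> Ck k O g.
Proof. by move=> oO fg /Ck_Cdir Cf; apply: Cdir_Ck => //; exact: Cdir_eq Cf. Qed.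

Lemma Ck_subset k O O' f : O' `<=` O -> Ck k O f -> Ck k O' f.
Proof.
move=> OO; elim: k f => [|k IH] f [cf H]; (split; first by move=> x /OO; exact: cf) => // i.
by have [df Cf] := H i; split; [move=> x /OO; exact: df|exact: IH].
Qed.

Lemma coord_der x i j :
  is_derive x (basis_vector i) (fun y : 'rV[R]_n => y ord0 j) (i == j)%:R.
Proof.
have E : (fun h : R => h^-1 *: ((h *: basis_vector i + x) ord0 j - x ord0 j)) @ 0^' -->
    ((i == j)%:R : R).
  apply: cvg_near_cst; near=> h.
  have h0 : h != 0 by near: h; exact: nbhs_dnbhs_neq.
  rewrite !mxE addrK eqxx /= [j == i]eq_sym scalerAl.
  by rewrite -[LHS]/(h^-1 * h * _) mulVf// mul1r.
apply: DeriveDef; first by apply/cvg_ex; eexists; exact: E.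
exact: cvg_lim E.
Unshelve. all: by end_near. Qed.

Lemma coord_cont x j : {for x, continuous (fun y : 'rV[R]_n => y ord0 j)}.
Proof. exact: coord_continuous. Qed.

Lemma CRn_coord k O j : CRn k O (fun y : 'rV[R]_n => y ord0 j).
Proof.
case: k => [|k]; (split; first by move=> x _; exact: coord_cont) => // i.
by exists (fun=> (i == j)%:R) => [x _|]; [exact: coord_der|exact: Cdir_cst].
Qed.

Definition sqnorm x : R := \sum_(i < n) x ord0 i ^+ 2.

Lemma sqnorm_ge0 x : 0 <= sqnorm x.
Proof. by apply: sumr_ge0 => i _; exact: sqr_ge0. Qed.

Lemma sqr_enorm x : enorm x ^+ 2 = sqnorm x.
Proof. by rewrite sqr_sqrtr// sqnorm_ge0. Qed.

Lemma enorm_ge0 x : 0 <= enorm x.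
Proof. exact: sqrtr_ge0. Qed.

Lemma sqnorm_eq0 x : sqnorm x = 0 -> x = 0.
Proof.
move=> /eqP; rewrite psumr_eq0; last by move=> i _; exact: sqr_ge0.
move=> /allP x0; apply/rowP => i; rewrite mxE; apply/eqP.
by rewrite -sqrf_eq0; apply: x0; rewrite mem_index_enum.
Qed.

Lemma enorm_gt0 x : x != 0 -> 0 < enorm x.
Proof.
move=> x0; rewrite lt_neqAle enorm_ge0 andbT eq_sym; apply: contraNN x0 => /eqP x0.
by apply/eqP/sqnorm_eq0; rewrite -sqr_enorm x0 expr0n.
Qed.

Lemma enorm0 : enorm (0 : 'rV[R]_n) = 0.
Proof.
by rewrite /enorm big1 ?sqrtr0// => i _; rewrite mxE expr0n.
Qed.

Lemma sqnorm_der x i : is_derive x (basis_vector i) sqnorm (2 * x ord0 i).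
Proof.
have H j : is_derive x (basis_vector i) (fun y : 'rV[R]_n => y ord0 j ^+ 2)
    (2 * x ord0 j * (i == j)%:R).
  by apply: (der_eq _ (derX 2 (coord_der x i j))); rewrite expr1.
have := @is_derive_sum _ _ _ n
    (fun (j : 'I_n) (y : 'rV[R]_n) => y ord0 j ^+ 2) x (basis_vector i) _ H.
have -> : \sum_(j < n) 2 * x ord0 j * (i == j)%:R = 2 * x ord0 i.
  rewrite (bigD1 i) //= eqxx mulr1 big1 ?addr0// => j /negbTE.
  by rewrite eq_sym => ->; rewrite mulr0.
congr (is_derive _ _ _ _); apply/funext => y.
by rewrite /sqnorm fct_sumE.
Qed.

Lemma enorm_der x i : x != 0 ->
  is_derive x (basis_vector i) (@enorm R n) (x ord0 i / enorm x).
Proof.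
move=> x0; have e0 := enorm_gt0 x0.
have s0 : 0 < sqnorm x by rewrite -sqr_enorm exprn_gt0.
apply: (der_eq _ (der_comp (sqnorm_der x i) (is_derive1_sqrt s0))).
rewrite -/(enorm x) invfM mulrACA mulVf// mul1r mulrC; field.
by rewrite gt_eqF.
Qed.

Lemma sqnorm_continuous : continuous sqnorm.
Proof.
move=> x; apply: for_continuous_sum => i.
by apply: for_continuousX; exact: coord_cont.
Qed.

Lemma enorm_continuous : continuous (@enorm R n).
Proof.
move=> x; apply: (@for_continuous_comp _ _ Num.sqrt sqnorm).
  exact: sqnorm_continuous.
exact: sqrt_continuous.
Qed.

Definition annulus (a b : R) : set 'rV[R]_n := [set x | a < enorm x < b].

Lemma open_annulus a b : open (annulus a b).
Proof.
apply: (@open_comp _ _ _ [set r : R | a < r < b]); last exact: open_oo.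
by move=> x _; exact: enorm_continuous.
Qed.

Lemma open_eball (T : \bar R) : open (@eball R n T).
Proof.
case: T => [T| |].
- rewrite (_ : eball _ = @enorm R n @^-1` [set r | r < T]); last first.
    by apply/seteqP; split=> x /=; rewrite /eball/= lte_fin.
  apply: open_comp; last exact: open_lt.
  by move=> x _; exact: enorm_continuous.
- rewrite (_ : eball _ = setT); first exact: openT.
  by apply/seteqP; split=> x //= _; rewrite /eball/= ltry.
- rewrite (_ : eball _ = set0); first exact: open0.
  by apply/seteqP; split=> x //=; rewrite /eball/= ltNge leNye.
Qed.

Lemma annulus_neq0 a b x : 0 <= a -> annulus a b x -> x != 0.
Proof.
move=> a0 /andP[ax _]; apply: contraTneq ax => ->.
by rewrite enorm0 -leNgt.
Qed.

Lemma radial_der (w : R -> R) (d : R) x i : x != 0 -> is_derive (enorm x) 1 w d ->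
  is_derive x (basis_vector i) (radial w) (d / enorm x * x ord0 i).
Proof.
move=> x0 dw; apply: (der_eq _ (der_comp (enorm_der i x0) dw)).
by rewrite mulrAC mulrA.
Qed.

(** A partial derivative of a radial function is the radial function of profile [w' / r] times a
    coordinate, so the induction closes; [0 <= a] keeps the origin out. *)
Lemma CRn_radial k a b (w : R -> R) : 0 <= a -> Creal k a b w ->
  CRn k (annulus a b) (radial w).
Proof.
move=> a0; elim: k w => [|k IH] w Cw.
  split=> // x /= xab; apply: for_continuous_comp; first exact: enorm_continuous.
  exact: Cw.1.
split=> [x xab|i].
  apply: for_continuous_comp; first exact: enorm_continuous.
  exact: Cw.1.
have [w' dw Cw'] := Cw.2 tt.
exists (fun x => radial (fun r => w' r / r) x * x ord0 i); last first.
  apply: CdirM; last exact: CRn_coord.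
  by apply: IH; apply: CdirM => //; exact: Creal_inv.
by move=> x xab; apply: radial_der; [exact: annulus_neq0 xab|exact: dw].
Qed.

End euclidean_norm.
Arguments open_annulus {R n} a b.
Arguments open_eball {R n} T.

Section radial_laplacian.
Context {R : realType} {N : nat}.
Implicit Types (w : R -> R) (f : 'rV[R]_N.+1 -> R) (x : 'rV[R]_N.+1).
Let e1 : 'rV[R]_N.+1 := basis_vector ord0.

Lemma pderiv_eq (O : set 'rV[R]_N.+1) f g i x : open O -> O x ->
  (forall y, O y -> f y = g y) -> pderiv i f x = pderiv i g x.
Proof.
move=> oO Ox fg; apply: near_eq_derive.
by apply: filterS (open_nbhs_nbhs (conj oO Ox)).
Qed.

Lemma laplacian_radial (a b : R) f w w1 w2 : 0 <= a ->
  (forall r, a < r < b -> is_derive r 1 w (w1 r) /\ is_derive r 1 w1 (w2 r)) ->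
  (forall x, annulus a b x -> f x = radial w x) ->
  forall x, annulus a b x -> laplacian f x = w2 (enorm x) + N%:R / enorm x * w1 (enorm x).
Proof.
move=> a0 dw fw x xab; have x0 := annulus_neq0 a0 xab.
have r0 := enorm_gt0 x0; set r := enorm x in r0 *; have rn0 : r != 0 by rewrite gt_eqF.
have p1 i y : annulus a b y -> pderiv i f y = radial (fun r => w1 r / r) y * y ord0 i.
  move=> yab; rewrite (pderiv_eq _ (open_annulus a b) yab fw).
  by have [_ <-] := radial_der i (annulus_neq0 a0 yab) (dw _ yab).1.
have p2 i : pderiv i (pderiv i f) x =
    (w2 r / r - w1 r / r ^+ 2) / r * x ord0 i ^+ 2 + w1 r / r.
  rewrite (pderiv_eq _ (open_annulus a b) xab (p1 i)).
  have d : is_derive r 1 (fun r => w1 r / r) (w2 r / r - w1 r / r ^+ 2).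
    have dinv := @derV R _ (fun s : R => s) r 1 1 rn0 (der_id r).
    by apply: (der_eq _ (derM (dw r xab).2 dinv)); field; rewrite rn0.
  have [_ E] := derM (radial_der i x0 d) (coord_der x i i).
  rewrite /pderiv E eqxx mulr1 addrC -/r; congr (_ + _).
  by rewrite /= -mulrA -expr2.
rewrite /laplacian (eq_bigr _ (fun i _ => p2 i)) big_split/= -mulr_sumr.
rewrite sumr_const card_ord -/(sqnorm x) -sqr_enorm -/r -[_ *+ _]mulr_natr.
by rewrite -natr1; field.
Qed.

Lemma enorm_axis (t : R) : enorm (t *: e1) = `|t|.
Proof.
rewrite /enorm (bigD1 ord0)//= big1 ?addr0.
  by rewrite !mxE eqxx mulr1 sqrtr_sqr.
by move=> i i0; rewrite !mxE (negbTE i0) andbF mulr0 expr0n.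
Qed.

Lemma axis_der f (t d : R) : is_derive (t *: e1) e1 f d ->
  is_derive t 1 (fun s => f (s *: e1)) d.
Proof.
move=> [df <-].
have E : (fun h : R => h^-1 *: (f ((h *: 1 + t) *: e1) - f (t *: e1))) =
    (fun h => h^-1 *: (f (h *: e1 + t *: e1) - f (t *: e1))).
  by apply/funext => h; rewrite [h *: 1]mulr1 scalerDl.
by apply: DeriveDef; rewrite /derivable /derive /= E.
Qed.

Lemma axis_continuous : continuous (fun t : R => t *: e1).
Proof. by move=> t; apply: cvgZr_tmp; exact: cvg_id. Qed.

(** Restriction to the first axis recovers the profile: partial derivatives of [f] along [e1] are
    derivatives of [w], whose regularity is thus derived rather than assumed. *)
Lemma radial_radlap (b : R) f w : Ck 2 (annulus 0 b) f ->
  (forall x, annulus 0 b x -> f x = radial w x) ->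
  radlap_eq N 0 b w (derive1 w) (radlap N.+1 w) /\
  forall x, annulus 0 b x -> laplacian f x = radlap N.+1 w (enorm x).
Proof.
move=> Cf fw.
have ax r : 0 < r < b -> annulus 0 b (r *: e1).
  by move=> /andP[r0 rb]; rewrite /annulus/= enorm_axis gtr0_norm// r0.
pose w1 (r : R) := pderiv ord0 f (r *: e1).
pose w2 (r : R) := pderiv ord0 (pderiv ord0 f) (r *: e1).
have near_rb (P : R -> Prop) r : 0 < r < b -> (forall s, 0 < s < b -> P s) ->
    \forall s \near r, P s.
  by move=> rb H; apply: filterS (open_nbhs_nbhs (conj (open_oo 0 b) rb)).
have dw r : 0 < r < b -> is_derive r 1 w (w1 r).
  move=> rb; apply: (@der_near _ (fun s => f (s *: e1))).
    apply: near_rb rb _ => s sb; rewrite fw; last exact: ax.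
    by rewrite /radial enorm_axis gtr0_norm//; case/andP: sb.
  by apply: axis_der; apply: Ck_derive Cf _; exact: ax.
have w1E r : 0 < r < b -> w1 r = derive1 w r.
  by move=> /dw[_ E]; rewrite derive1E E.
have dw1 r : 0 < r < b -> is_derive r 1 (derive1 w) (w2 r).
  move=> rb; apply: (@der_near _ w1); first exact: near_rb rb w1E.
  by apply: axis_der; apply: (Ck_derive (k := 0)); [exact: (Ck_pderiv _ Cf)|exact: ax].
have rlE r : 0 < r < b -> radlap N.+1 w r = w2 r + N%:R / r * derive1 w r.
  move=> rb; rewrite /radlap gt_eqF; last by case/andP: rb.
  by have [_ <-] := dw1 r rb; rewrite [in LHS]derive1E.
split.
  apply/radlap_eqP => // r rb; rewrite -w1E//; split; first exact: dw.
  by rewrite rlE// w1E// addrK; exact: dw1.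
move=> x xb; rewrite rlE//.
apply: (@laplacian_radial 0 b f w (derive1 w) w2 (lexx 0) _ fw x xb) => r rb.
split; last exact: dw1.
by apply: (der_eq _ (dw r rb)); exact: w1E.
Qed.

End radial_laplacian.

Section iterated_radlap.
Context {R : realType} {N : nat}.
Implicit Types (f g h u : R -> R) (a b r : R).

Lemma radlap_eq_eql a b f g f1 h : (forall r, a < r < b -> f r = g r) ->
  radlap_eq N a b f f1 h -> radlap_eq N a b g f1 h.
Proof.
move=> fg fh r rab; have [df dg] := fh r rab; split=> //.
apply: der_near df.
by apply: filterS (open_nbhs_nbhs (conj (open_oo a b) rab)) => s; exact: fg.
Qed.

Lemma radlap_eq_radlap a b f f1 h : 0 <= a -> radlap_eq N a b f f1 h ->
  forall r, a < r < b -> radlap N.+1 f r = h r.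
Proof.
move=> a0 /(radlap_eqP _ _ _ _ _ a0) fh r rab.
have d1 s : a < s < b -> f1 s = derive1 f s.
  by move=> /fh[[_ E] _]; rewrite derive1E E.
have dd : is_derive r 1 (derive1 f) (h r - N%:R / r * f1 r).
  apply: der_near (fh r rab).2.
  by apply: filterS (open_nbhs_nbhs (conj (open_oo a b) rab)) => s; exact: d1.
have rn0 : (r == 0) = false.
  by rewrite gt_eqF// (le_lt_trans a0)//; case/andP: rab.
by rewrite /radlap rn0 -d1// derive1E; have [_ ->] := dd; rewrite subrK.
Qed.

Lemma iter_radlap (c : R) a b (m : nat) (w w1 : nat -> R -> R) u : 0 <= a ->
  (forall i, (i < m)%N -> radlap_eq N a b (w i) (w1 i) (w i.+1)) ->
  (forall r, a < r < b -> u r = w 0%N r) ->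
  forall i, (i <= m)%N -> forall r, a < r < b ->
    iter i (fun w s => c * radlap N.+1 w s) u r = c ^+ i * w i r.
Proof.
move=> a0 Hw uw; elim=> [|i IH] im r rab; first by rewrite /= expr0 mul1r uw.
have H := radlap_eqZ (c ^+ i) (Hw i im).
have H' := radlap_eq_eql (fun s sab => esym (IH (ltnW im) s sab)) H.
by rewrite iterS (radlap_eq_radlap a0 H' rab) exprS mulrA.
Qed.

End iterated_radlap.

Lemma iter_radlap1 {R : realType} n i (u : R -> R) :
  iter i (fun w s => 1 * radlap n w s) u = iter i (radlap n) u.
Proof. by apply: eq_iter => w; apply/funext => s; rewrite mul1r. Qed.

Lemma iter_radlapN {R : realType} n i (u : R -> R) :
  iter i (fun w s => -1 * radlap n w s) u = iter i (fun w s => - radlap n w s) u.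
Proof. by apply: eq_iter => w; apply/funext => s; rewrite mulN1r. Qed.

(** Constants are pulled out of partial derivatives that exist, whence the bookkeeping of the
    remaining order [2 * (m - j)]. *)
Lemma iter_laplacianZ {R : realType} n (c : R) i m (f : 'rV[R]_n -> R) : (i <= m)%N ->
  Ck (2 * m) setT f ->
  iter i (fun f x => c * laplacian f x) f = (fun x => c ^+ i * iter i (@laplacian R n) f x).
Proof.
move=> im Cf.
have Ci j : (j <= m)%N -> Ck (2 * (m - j)) setT (iter j (@laplacian R n) f).
  elim: j => [|j IH] jm; first by rewrite subn0.
  apply: (Ck_laplacian openT); rewrite (_ : _.+2 = 2 * (m - j))%N; first exact: IH (ltnW jm).
  by rewrite -(subnSK jm) mulnS.
elim: i im => [|i IH] im; first by apply/funext => x; rewrite expr0 mul1r.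
have {}IH := IH (ltnW im); rewrite iterS IH; apply/funext => x.
have C2 : Ck 2 setT (iter i (@laplacian R n) f).
  by apply: Ck_leq (Ci i (ltnW im)); rewrite leq_pmulr ?subn_gt0.
have pZ g j : Ck 1 setT g -> pderiv j (fun x => c ^+ i * g x) = (fun x => c ^+ i * pderiv j g x).
  move=> Cg; apply/funext => y.
  by have [_ <-] := derZ (c ^+ i) (Ck_derive j Cg (I : setT y)).
rewrite exprS -mulrA; congr (_ * _); rewrite /laplacian /= mulr_sumr.
apply: eq_bigr => j _; rewrite !pZ//; first exact: Ck_pderiv C2.
exact: Ck_leq C2.
Qed.

(** * The profile of a radial solution and its behaviour at the origin *)

Section radial_solution_profile.
Context {R : realType} {N m : nat} (alpha : 'I_m -> R) (T : \bar R) (u : R -> R).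
Hypothesis sol : radial_solution N.+1 alpha T u.

Let v k := iter k (radlap N.+1) u.
Let F k := iter k (@laplacian R N.+1) (radial u).
Let e1 : 'rV[R]_N.+1 := basis_vector ord0.

Let T0 : (0 < T)%E. Proof. by case: sol. Qed.
Let ball0 : eball T (0 : 'rV[R]_N.+1). Proof. by rewrite /eball/= enorm0. Qed.

Lemma profile_Ck k : (k <= m)%N -> Ck (2 * (m - k)) (eball T) (F k).
Proof.
elim: k => [|k IH] km; first by rewrite subn0; case: sol.
rewrite /F iterS; apply: (Ck_laplacian (open_eball T)).
rewrite (_ : _.+2 = 2 * (m - k))%N; first exact: IH (ltnW km).
by rewrite -(subnSK km) mulnS.
Qed.

Let annulus_eball b : (b%:E <= T)%E -> annulus 0 b `<=` (@eball R N.+1 T).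
Proof.
move=> bT x /andP[_ xb]; rewrite /eball/=.
by apply: lt_le_trans bT; rewrite lte_fin.
Qed.

Let eball_annulus (x : 'rV[R]_N.+1) : eball T x -> x != 0 ->
  exists2 b, (b%:E <= T)%E & annulus 0 b x.
Proof.
rewrite /eball /annulus /= => xT /enorm_gt0 ->.
case: T xT => [t| |]//= xt; first by exists t.
by exists (enorm x + 1); rewrite ?leey// ltrDl.
Qed.

(** Agreement at level [k] lets [radial_radlap] produce agreement at level [k.+1]. The origin is
    left out because [radlap] is a limit there. *)
Lemma profile_radial k : (k <= m)%N ->
  (forall x, eball T x -> x != 0 -> F k x = radial (v k) x) /\
  ((k < m)%N -> forall b, (b%:E <= T)%E ->
    radlap_eq N 0 b (v k) (derive1 (v k)) (v k.+1)).
Proof.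
elim: k => [|k IH] km.
  split; first by [].
  move=> km' b bT; apply: (@radial_radlap R N b (F 0) (v 0) _ (fun _ _ => erefl)).1.
  apply: Ck_subset (annulus_eball bT) _; apply: Ck_leq (profile_Ck km).
  by rewrite subn0 leq_pmulr.
have [Fv] := IH (ltnW km); move=> /(_ km) _.
have step b : (b%:E <= T)%E -> forall x, annulus 0 b x -> F k.+1 x = radial (v k.+1) x.
  move=> bT x xb; have := @radial_radlap R N b (F k) (v k).
  move=> /(_ _ _)[| |_ L]; last exact: L.
  - apply: Ck_subset (annulus_eball bT) _; apply: Ck_leq (profile_Ck (ltnW km)).
    by rewrite leq_pmulr// subn_gt0.
  - move=> y yb; apply: Fv; first exact: annulus_eball yb.
    exact: annulus_neq0 yb.
have Fv1 x : eball T x -> x != 0 -> F k.+1 x = radial (v k.+1) x.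
  by move=> xT x0; have [b bT] := eball_annulus xT x0; exact: step.
split; first exact: Fv1.
move=> km' b bT; apply: (@radial_radlap R N b (F k.+1) (v k.+1) _ (step b bT)).1.
apply: Ck_subset (annulus_eball bT) _; apply: Ck_leq (profile_Ck km).
by rewrite leq_pmulr// subn_gt0.
Qed.

Let small_r : \forall r \near (0 : R)^'+, 0 < r /\ (r%:E < T)%E.
Proof.
have [b b0 bT] : exists2 b : R, 0 < b & (b%:E <= T)%E.
  case: T T0 => [t| |]//; first by rewrite lte_fin; exists t.
  by exists 1; rewrite ?leey.
near=> r; split; first by near: r; exact: nbhs_right_gt.
by apply: lt_le_trans bT; rewrite lte_fin; near: r; exact: nbhs_right_lt.
Unshelve. all: by end_near. Qed.

Let axis_eball r : 0 < r -> (r%:E < T)%E -> eball T (r *: e1) /\ r *: e1 != 0.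
Proof.
move=> r0 rT; split; first by rewrite /eball/= enorm_axis gtr0_norm.
apply/eqP => /(congr1 (@enorm R N.+1)); rewrite enorm_axis enorm0 gtr0_norm// => r0'.
by rewrite r0' ltxx in r0.
Qed.

Let profile_axis k r : (k <= m)%N -> 0 < r -> (r%:E < T)%E -> v k r = F k (r *: e1).
Proof.
move=> km r0 rT; have [rb rn0] := axis_eball r0 rT.
by rewrite (profile_radial km).1// /radial enorm_axis gtr0_norm.
Qed.

Let axis_cvg0 (g : 'rV[R]_N.+1 -> R) : {for 0, continuous g} ->
  g (r *: e1) @[r --> (0 : R)^'+] --> g 0.
Proof.
move=> cg; apply: cvg_at_right_filter.
apply: (@cvg_comp _ _ _ (fun r : R => r *: e1) g _ (nbhs (0 : 'rV[R]_N.+1))); last exact: cg.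
by have := @axis_continuous R N 0; rewrite /continuous_at scale0r.
Qed.

(** [F k] is continuous at the origin, so along the axis the profile tends to [F k 0]; for [k > 0]
    this limit is by definition the value of [v k] at 0. *)
Lemma profile_origin k : (k <= m)%N -> v k 0 = F k 0 /\ v k x @[x --> 0^'+] --> v k 0.
Proof.
move=> km.
have cF : F k (r *: e1) @[r --> 0^'+] --> F k 0.
  by apply: axis_cvg0; apply: Ck_continuous (profile_Ck km) ball0.
have cv : v k x @[x --> 0^'+] --> F k 0.
  apply: cvg_trans cF; apply: near_eq_cvg.
  by apply: filterS small_r => r [r0 rT]; rewrite profile_axis.
suff v0 : v k 0 = F k 0 by rewrite v0.
case: k km cF cv => [|k] km cF cv; first by rewrite /v /F /= /radial enorm0.
rewrite {1}/v iterS /radlap eqxx; apply: cvg_lim => //.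
apply: cvg_trans cv; apply: near_eq_cvg.
by apply: filterS small_r => r [r0 rT]; rewrite /v iterS /radlap gt_eqF.
Qed.

Lemma profile_eball k x : (k <= m)%N -> eball T x -> F k x = v k (enorm x).
Proof.
move=> km xT; have [->|x0] := eqVneq x 0; last by rewrite (profile_radial km).1.
by rewrite enorm0 (profile_origin km).1.
Qed.

(** The initial condition concerns a derivative at 0, whereas the flux arguments need a limit of
    derivatives. Since [F k] is [C^1], its axial derivative is continuous, and the condition on the
    even extension makes it vanish at the origin. *)
Lemma profile_derive_origin k : (k < m)%N -> derive1 (v k) x @[x --> 0^'+] --> 0.
Proof.
move=> km; have km' := ltnW km.
have C1 : Ck 1 (eball T) (F k).
  apply: Ck_leq (profile_Ck km'); rewrite muln_gt0/= subn_gt0//.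
have small0 : \forall r \near (0 : R), eball T (r *: e1).
  have : nbhs (0 *: e1) (@eball R N.+1 T).
    by rewrite scale0r; apply: open_nbhs_nbhs; split=> //; exact: open_eball.
  exact: (@axis_continuous R N (0 : R)).
have d0 : pderiv ord0 (F k) 0 = 0.
  have [_ _ _ /(_ (Ordinal km))[_ dv]] := sol.
  apply: (@der_unique _ (fun r => F k (r *: e1)) 0).
    by apply: axis_der; rewrite scale0r; exact: (Ck_derive _ C1).
  apply: (der_near _ dv); apply: filterS small0 => r rT.
  by rewrite profile_eball// enorm_axis.
suff : derive1 (v k) x @[x --> 0^'+] --> pderiv ord0 (F k) 0 by rewrite d0.
have cF : pderiv ord0 (F k) (r *: e1) @[r --> 0^'+] --> pderiv ord0 (F k) 0.
  exact: (axis_cvg0 (Ck_continuous (Ck_pderiv ord0 C1) ball0)).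
apply: cvg_trans cF; apply: near_eq_cvg.
apply: filterS small_r => r [r0 rT].
have [rb _] := axis_eball r0 rT.
have : is_derive r 1 (v k) (pderiv ord0 (F k) (r *: e1)).
  apply: (@der_near _ (fun s => F k (s *: e1))); last first.
    by apply: axis_der; exact: (Ck_derive _ C1).
  have rb' : nbhs (r *: e1) (@eball R N.+1 T).
    by apply: open_nbhs_nbhs; split=> //; exact: open_eball.
  near=> s; rewrite profile_eball//; last by near: s; exact: (@axis_continuous R N r).
  rewrite enorm_axis gtr0_norm//; near: s; exact: lt_nbhsr.
by move=> [_ <-]; rewrite derive1E.
Unshelve. all: by end_near. Qed.

Lemma profile_top r : odd m -> 0 < r -> (r%:E < T)%E -> v m r = - expR (u r).
Proof.
move=> mo r0 rT; have [_ _ eqn _] := sol; rewrite -eqn//.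
have [rb rn0] := axis_eball r0 rT.
have [b bT rb'] := eball_annulus rb rn0.
have rb2 : 0 < r < b by move: rb'; rewrite /annulus/= enorm_axis gtr0_norm.
rewrite -iter_radlapN (@iter_radlap _ N (-1) 0 b m v (fun k => derive1 (v k)) u (lexx 0))//.
  by rewrite -signr_odd mo expr1 mulN1r opprK.
by move=> i im; apply: (profile_radial (ltnW im)).2.
Qed.

End radial_solution_profile.

(** * Continuation past a finite radius *)

Section continuation.
Context {R : realType}.

(** The range [r < t] with [t > 0] includes 0, where the value is a right limit that sees only small
    positive radii. *)
Lemma radlap_local n (t : R) (f g : R -> R) : 0 < t ->
  (forall r, r < t -> f r = g r) -> forall r, r < t -> radlap n f r = radlap n g r.
Proof.
move=> t0 fg r rt.
have near_t s (P : R -> Prop) : s < t -> (forall s, s < t -> P s) -> \forall y \near s, P y.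
  by move=> st H; apply: filterS (lt_nbhsl st).
have d1 s : s < t -> derive1 f s = derive1 g s.
  by move=> st; rewrite !derive1E; apply: near_eq_derive; exact: near_t st fg.
have L s : s < t -> derive1 (derive1 f) s + n.-1%:R / s * derive1 f s =
    derive1 (derive1 g) s + n.-1%:R / s * derive1 g s.
  move=> st; rewrite (d1 s st).
  have -> : derive1 (derive1 f) s = derive1 (derive1 g) s; last by [].
  by rewrite !derive1E; apply: near_eq_derive; exact: near_t st d1.
rewrite /radlap; case: ifPn => [_|_]; last exact: L.
have nL : \forall s \near (0 : R)^'+, derive1 (derive1 f) s + n.-1%:R / s * derive1 f s =
    derive1 (derive1 g) s + n.-1%:R / s * derive1 g s.
  by near=> s; apply: L; near: s; exact: nbhs_right_lt.
congr (lim _); apply/seteqP; split; apply: near_eq_cvg => //.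
by apply: filterS nL.
Unshelve. all: by end_near. Qed.

Lemma iter_radlap_local n (c t : R) i (f g : R -> R) : 0 < t ->
  (forall r, r < t -> f r = g r) -> forall r, r < t ->
  iter i (fun w s => c * radlap n w s) f r = iter i (fun w s => c * radlap n w s) g r.
Proof.
move=> t0 fg; elim: i => [|i IH] r rt; first exact: fg.
by rewrite !iterS (radlap_local n t0 IH rt).
Qed.

(** Only upper bounds pass down the chain, because [- exp u] has a sign but no lower bound yet. An
    upper bound of [u] is what the truncation of the exponential asks for. *)
Lemma radlap_chain_upper_bound N m (t : R) (v v1 : nat -> R -> R) : 0 < t ->
  (forall i, (i < m)%N -> radlap_eq N 0 t (v i) (v1 i) (v i.+1)) ->
  (forall i, (i < m)%N -> v i x @[x --> 0^'+] --> v i 0) ->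
  (forall i, (i < m)%N -> v1 i x @[x --> 0^'+] --> 0) ->
  (forall r, 0 < r < t -> v m r <= 0) ->
  exists M, forall r, 0 < r < t -> v 0%N r <= M.
Proof.
move=> t0 H v0 v10 vm.
suff S j : (j <= m)%N -> exists2 M, 0 <= M & forall r, 0 < r < t -> v (m - j)%N r <= M.
  by have [M _ HM] := S m (leqnn m); exists M => r; rewrite -(subnn m); exact: HM.
elim: j => [_|j IH jm]; first by exists 0 => //; rewrite subn0.
have [M M0 HM] := IH (ltnW jm); set i := (m - j.+1)%N.
have im : (i < m)%N by rewrite ltn_subrL (leq_ltn_trans _ jm).
have Mv r : 0 < r < t -> v i.+1 r <= M by rewrite /i subnSK//; exact: HM.
exists (`|v i 0| + M * t ^+ 2); first by rewrite addr_ge0// mulr_ge0// sqr_ge0.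
move=> r rt; apply: (le_trans (radlap_le_par (H i im) (v0 i im) (v10 i im) M0 Mv rt).2).
apply: lerD; first exact: ler_norm.
apply: ler_wpM2l => //; case/andP: rt => r0 rt.
by apply: lerXn2r; rewrite ?nnegrE ltW.
Qed.

Lemma radlap_chain_Creal N m (a b : R) (w w1 : nat -> R -> R) : 0 <= a ->
  (forall i, (i < m)%N -> radlap_eq N a b (w i) (w1 i) (w i.+1)) ->
  continuous (w m) -> Creal (2 * m) a b (w 0%N).
Proof.
move=> a0 H cw.
suff S j : (j <= m)%N -> Creal (2 * j) a b (w (m - j)%N).
  by have := S m (leqnn m); rewrite subnn.
elim: j => [_|j IH jm]; first by rewrite subn0; split=> // x _; exact: cw.
have im : (m - j.+1 < m)%N by rewrite ltn_subrL (leq_ltn_trans _ jm).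
rewrite mulnS; apply: (radlap_Creal a0 (H _ im)).
by rewrite subnSK//; exact: IH (ltnW jm).
Qed.

Context {N m : nat} (alpha : 'I_m -> R) (T : \bar R) (u : R -> R).
Hypotheses (mo : odd m) (max : maximal_radial_solution N.+1 alpha T u).

Lemma maximal_solution_global : T = +oo%E.
Proof.
have m0 : (0 < m)%N by case: m mo.
have [sol maximality] := max; have [T0 Cu eqn init] := sol.
case: T T0 Cu eqn sol maximality => [t| |]// T0 Cu eqn sol maximality.
rewrite lte_fin in T0.
pose v k := iter k (radlap N.+1) u.
have Hv i : (i < m)%N -> radlap_eq N 0 t (v i) (derive1 (v i)) (v i.+1).
  by move=> im; apply: (profile_radial sol (ltnW im)).2.
have vm r : 0 < r < t -> v m r = - expR (v 0%N r).
  by move=> /andP[r0 rt]; apply: (profile_top sol); rewrite ?lte_fin.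
have [M vM] : exists M, forall r, 0 < r < t -> v 0%N r <= M.
  apply: (@radlap_chain_upper_bound N m t v (fun k => derive1 (v k))) => //.
  - by move=> i im; have [] := profile_origin sol (ltnW im).
  - by move=> i im; exact: (profile_derive_origin sol).
  - by move=> r rt; rewrite vm// oppr_le0 expR_ge0.
pose a := t / 2.
have [a0 at_] : 0 < a /\ a < t by rewrite /a; split; lra.
have aat : 0 < a < t by rewrite a0.
have sub r : a <= r < t -> 0 < r < t.
  by move=> /andP[ar ->]; rewrite (lt_le_trans a0).
have [||w [w1 [T' tT' [cw wr wm wv]]]] := @radial_solution_extends R N m a t M v
  (fun k => derive1 (v k)) m0 aat Hv.
- by move=> r /sub; exact: vm.
- by move=> r /sub; exact: vM.
pose c := (a + t) / 2; have [ac ct] : a < c /\ c < t by rewrite /c; split; lra.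
(* As [u] and [w 0] agree on [[a, t)], which contains [c], the function [z] is [u] below [t] and
   [w 0] on [(a, T')]; regularity and the equation are checked on these two pieces. *)
pose z r := if r < c then u r else w 0%N r.
have zu r : r < t -> z r = u r.
  move=> rt; rewrite /z; case: ltP => // cr; rewrite wv//.
  by rewrite rt (le_trans (ltW ac)).
have zw r : a < r < T' -> z r = w 0%N r.
  move=> /andP[ar _]; rewrite /z; case: ltP => // rc; rewrite wv//.
  by rewrite (ltW ar) (lt_trans rc).
have wr' i : (i < m)%N -> radlap_eq N a T' (w i) (w1 i) (w i.+1).
  by move=> im; apply: radlap_eq_sub (wr i im) => //; rewrite ler_pdivrMr//; lra.
have T'0 : 0 < T' := lt_trans T0 tT'.
exfalso; apply: (maximality T'%:E z); last by move=> r _; rewrite lte_fin; exact: zu.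
  by rewrite lte_fin.
split.
- by rewrite lte_fin.
- have C1 : Ck (2 * m) (eball t%:E) (@radial R N.+1 z).
    apply: (Ck_eq (open_eball _) _ Cu) => x; rewrite /eball/= lte_fin => xt.
    by rewrite /radial zu.
  have C2 : Ck (2 * m) (annulus a T') (@radial R N.+1 z).
    apply: (Cdir_Ck (open_annulus a T')).
    apply: (@Cdir_eq _ _ _ _ _ _ (radial (w 0%N)) _ (open_annulus a T')).
      by move=> x xa; rewrite /radial zw.
    apply: CRn_radial; first exact: ltW.
    by apply: radlap_chain_Creal wr' _ => //; [exact: ltW|exact: cw].
  apply: Ck_subset (Ck_union C1 C2) => x; rewrite /eball/= lte_fin => xT'.
  have [xt|tx] := ltP (enorm x) t; first by left; rewrite /eball/= lte_fin.
  by right; rewrite /annulus/= (lt_le_trans at_).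
- move=> r r0; rewrite lte_fin => rT'; rewrite -iter_radlapN.
  have [rt|tr] := ltP r t.
    rewrite (iter_radlap_local _ _ _ T0 zu rt) iter_radlapN eqn ?lte_fin//.
    by rewrite zu.
  have ra : a < r < T' by rewrite (lt_le_trans at_).
  rewrite (@iter_radlap R N (-1) a T' m w w1 z (ltW a0) wr' zw)// wm; last first.
    by rewrite rT' ltW//; case/andP: ra.
  by rewrite -signr_odd mo expr1 mulN1r opprK zw.
- move=> k; have [ik dk] := init k.
  have E r : r < t -> iter k (radlap N.+1) z r = iter k (radlap N.+1) u r.
    by move=> rt; rewrite -!iter_radlap1; exact: (iter_radlap_local _ _ _ T0 zu rt).
  split; first by rewrite E.
  apply: (der_near _ dk); near=> r; apply/esym/E.
  have : ball (0 : R) t r by near: r; exact: nbhsx_ballx.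
  by rewrite /ball/= sub0r normrN.
Unshelve. all: by end_near. Qed.

End continuation.

Section global_solution.
Context {R : realType} {N m : nat} (alpha : 'I_m -> R) (u : R -> R).
Hypotheses (mo : odd m) (sol : radial_solution N.+1 alpha +oo%E u).

Let v k := iter k (radlap N.+1) u.

Let ballT : @eball R N.+1 +oo%E = setT.
Proof. by apply/seteqP; split=> x //= _; rewrite /eball/= ltry. Qed.

Lemma global_Ck : Ck (2 * m) setT (@radial R N.+1 u).
Proof. by rewrite -ballT; case: sol. Qed.

Lemma global_entire_solution : entire_solution m (@radial R N.+1 u).
Proof.
split; first exact: global_Ck.
have top x : iter m (@laplacian R N.+1) (radial u) x = v m (enorm x).
  by apply: (profile_eball sol (leqnn m)); rewrite ballT.
have top' r : 0 < r -> v m r = - expR (v 0%N r).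
  by move=> r0; apply: (profile_top sol mo r0); rewrite ltry.
have E : iter m (fun (f : 'rV[R]_N.+1 -> R) y => - laplacian f y) (radial u) =
    (fun x => - iter m (@laplacian R N.+1) (radial u) x).
  have := @iter_laplacianZ R N.+1 (-1) m m (radial u) (leqnn m) global_Ck.
  rewrite -signr_odd mo expr1 => H.
  have -> : (fun f y => - laplacian f y) =
      (fun (f : 'rV[R]_N.+1 -> R) x => -1 * laplacian f x).
    by apply/funext => f; apply/funext => x; rewrite mulN1r.
  by rewrite H; apply/funext => x; rewrite mulN1r.
move=> x; rewrite E top; have [x0|xn0] := eqVneq (enorm x) 0; last first.
  have r0 : 0 < enorm x by rewrite lt_neqAle eq_sym xn0 enorm_ge0.
  by rewrite (top' _ r0) opprK.
rewrite /radial x0.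
(* The radial equation is imposed for [r > 0] only; at the origin its two sides are identified as
   limits. *)
have c1 : v m r @[r --> 0^'+] --> v m 0 by have [] := profile_origin sol (leqnn m).
have [] := profile_origin sol (leq0n m); rewrite -/(v 0%N) => _ c0.
have c2 : - expR (v 0%N r) @[r --> 0^'+] --> - expR (v 0%N 0).
  by apply: cvgN; apply: continuous_cvg c0; exact: continuous_expR.
suff -> : v m 0 = - expR (v 0%N 0) by rewrite opprK.
apply: (cvg_unique _ c1) => //=.
apply: (cvg_trans _ c2); apply: near_eq_cvg.
by near=> r; rewrite top'//; near: r; exact: nbhs_right_gt.
Unshelve. all: by end_near. Qed.

Lemma global_decay : (exists2 k : 'I_m, (1 <= k)%N & Num.sg (alpha k) != (-1) ^+ k) ->
  exists e r1, [/\ 0 < e, 1 <= r1 & forall r, r1 <= r -> u r <= - e * r ^+ 2].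
Proof.
move=> [k k1 sk]; apply: (@radial_solution_decay R N v (fun i => derive1 (v i)) m k mo).
- by move=> i im b; apply: (profile_radial sol (ltnW im)).2; rewrite ?leey.
- by move=> i im; have [] := profile_origin sol (ltnW im).
- by move=> i im; exact: (profile_derive_origin sol).
- by move=> r r0; apply: (profile_top sol mo r0); rewrite ltry.
- by rewrite k1 ltn_ord.
- by have [_ _ _ /(_ k)[vk _]] := sol; rewrite /v vk.
Qed.

End global_solution.

(** * Integration on R^n *)

Section tuple_integration.
Context {R : realType}.
Local Notation tup n := (n.-tuple (measurableTypeR R)).

Definition row_of_tuple n (t : n.-tuple R) : 'rV[R]_n := \row_(i < n) tnth t i.

Lemma bounded_support_integrable d (X : measurableType d)
    (mu : {measure set X -> \bar R}) (A : set X) (f : X -> R) (K : R) :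
  measurable A -> (mu A < +oo)%E -> measurable_fun setT f ->
  (forall x, `|f x| <= K) -> (forall x, ~ A x -> f x = 0) ->
  mu.-integrable setT (EFin \o f).
Proof.
move=> mA Aoo mf fK fA.
have : mu.-integrable A (EFin \o f).
  apply: measurable_bounded_integrable => //; first exact: measurable_funS mf.
  exists K; split; first exact: num_real.
  by move=> y Ky x _ /=; rewrite (le_trans (fK x))// ltW.
move/(integrable_mkcond _ mA); congr (integrable _ _ _).
apply/funext => x; rewrite patchE; case: ifPn => // /negP xA /=.
by rewrite fA// => Ax; apply: xA; rewrite inE.
Qed.

(** The sigma-algebra on tuples comes from the coordinates. An open set is the union of the rational
    cubes inside it, of which there are countably many; [2 / (k + 1) < e] leaves room to move the
    centre to a rational point. *)
Lemma open_tuple_measurable n (O : set 'rV[R]_n) : open O ->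
  measurable ((@row_of_tuple n : tup n -> 'rV[R]_n) @^-1` O).
Proof.
move=> oO.
pose B (p : n.-tuple rat * nat) : set (tup n) :=
  [set t | forall i, `|tnth t i - ratr (tnth p.1 i)| < p.2.+1%:R^-1].
pose inO p := B p `<=` (@row_of_tuple n : tup n -> 'rV[R]_n) @^-1` O.
have -> : (@row_of_tuple n : tup n -> 'rV[R]_n) @^-1` O = \bigcup_(p in inO) B p.
  apply/seteqP; split=> [t Ot|t [p pO Bt]]; last exact: pO.
  have [e /= e0 He] : exists2 e : R, 0 < e & ball (row_of_tuple t) e `<=` O.
    by move: (oO _ Ot) => /nbhs_ballP[e e0 He]; exists e.
  pose k := Num.truncn (2 / e).
  have ke : 2 * k.+1%:R^-1 < e.
    have : 2 / e < k.+1%:R := truncnS_gt _.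
    rewrite ltr_pdivrMr// => H; rewrite ltr_pdivrMr ?ltr0n//.
    by rewrite mulrC.
  have c0 : (0 : R) < k.+1%:R^-1 by rewrite invr_gt0 ltr0n.
  have /choice[q qP] : forall i : 'I_n, exists q : rat, `|tnth t i - ratr q| < k.+1%:R^-1.
    move=> i; have [|q] := @rat_in_itvoo R (tnth t i - k.+1%:R^-1) (tnth t i + k.+1%:R^-1).
      by rewrite ltrD2l (lt_trans _ c0)// oppr_lt0.
    rewrite in_itv/= => /andP[q1 q2]; exists q.
    by rewrite ltr_distl ltrBlDr q2 -ltrBlDr.
  exists ([tuple q i | i < n], k); last by move=> i; rewrite tnth_mktuple.
  move=> s Bs; apply: He; split=> // i j; rewrite /row_of_tuple /ball /= !mxE.
  have := Bs j; rewrite tnth_mktuple/= => Bsj.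
  apply: lt_trans ke; rewrite mulr_natl mulr2n.
  apply: (le_lt_trans (ler_distD (ratr (q j)) _ _)).
  by apply: ltrD; [exact: qP|rewrite distrC].
rewrite bigcup_mkcond; apply: countable_bigcupT_measurable => // p.
case: ifPn => // _.
rewrite (_ : B p = \bigcap_(i in [set: 'I_n])
    ((fun t : tup n => tnth t i) @^-1` [set r | `|r - ratr (tnth p.1 i)| < p.2.+1%:R^-1])).
  apply: fin_bigcap_measurable => [|i _]; first exact: finite_finset.
  rewrite -[X in measurable X]setTI; apply: measurable_tnth => //.
  apply: open_measurable.
  apply: (@open_comp _ _ (fun r : R => `|r - ratr (tnth p.1 i)|) [set r | r < p.2.+1%:R^-1]).
    2: exact: open_lt.
  move=> x _.
  apply: (@for_continuous_comp _ _ (fun x : R => `|x|) (fun r => r - _)).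
    by apply: for_continuousD; [exact: cvg_id|exact: for_continuous_cst].
  exact: norm_continuous.
by apply/seteqP; split=> t /= H i; [move=> _; exact: H|exact: H i I].
Qed.

Lemma row_measurable n (f : 'rV[R]_n -> R) : continuous f ->
  measurable_fun setT (fun t : tup n => f (row_of_tuple t) : measurableTypeR R).
Proof.
move=> cf; apply: (measurability _ (RGenOpens.measurableE R)).
move=> _ [_ [a [b ->] <-]]; apply: measurableI => //.
rewrite -/(preimage _ _) (_ : _ @^-1` _ = (@row_of_tuple n : tup n -> 'rV[R]_n) @^-1`
  (f @^-1` `]a, b[))//.
apply: open_tuple_measurable; apply: open_comp; last exact: interval_open.
by move=> x _; exact: cf.
Qed.

End tuple_integration.

Section compact_support.
Context {R : realType}.
Local Notation tup n := (n.-tuple (measurableTypeR R)).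
Local Notation mu := (lebesgue_tuple R).

Definition box n (M : R) : set (tup n) := [set t | forall i, `|tnth t i| <= M].
Arguments box : clear implicits.

Lemma box_cons n (M : R) (a : R) (t : tup n) :
  box n.+1 M [tuple of a :: t] <-> `|a| <= M /\ box n M t.
Proof.
split=> [H|[aM tM] i].
  split; first by have := H ord0; rewrite tnth0.
  by move=> i; have := H (lift ord0 i); rewrite tnthS.
by case: (unliftP ord0 i) => [j|] ->; rewrite ?tnthS ?tnth0.
Qed.

Lemma measurable_box n M : measurable (box n M).
Proof.
rewrite (_ : box n M = \bigcap_(i in [set: 'I_n])
    ((fun t : tup n => tnth t i) @^-1` `[- M, M]%classic)).
  apply: fin_bigcap_measurable => [|i _]; first exact: finite_finset.
  by rewrite -[X in measurable X]setTI; apply: measurable_tnth.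
apply/seteqP; split=> t /= H i; first by move=> _; rewrite /= in_itv/= -ler_norml; exact: H.
by have := H i I; rewrite /= in_itv/= -ler_norml.
Qed.

Lemma box_preimage n M : @cons_pair R n @^-1` box n.+1 M = `[- M, M]%classic `*` box n M.
Proof.
by apply/seteqP; split=> -[a t] /=; rewrite box_cons in_itv/= -ler_norml.
Qed.

Lemma box_lty n M : (mu n (box n M) < +oo)%E.
Proof.
elim: n => [|n IH].
  by rewrite /= diracE ltry.
rewrite /= /lebesgue_tupleS /pushforward box_preimage product_measure1E//.
  have fin : lebesgue_measure (`[- M, M]%classic : set R) \is a fin_num.
    by rewrite lebesgue_measure_itv/=; case: ifPn.
  by apply: lte_mul_pinfty; [exact: measure_ge0|exact: fin|exact: IH].
exact: measurable_box.
Qed.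

Lemma box2_lty n (M : R) : ((lebesgue_measure \x mu n)%E (`[(- M)%R, M]%classic `*` box n M) < +oo)%E.
Proof. by have := box_lty n.+1 M; rewrite /= /lebesgue_tupleS /pushforward box_preimage. Qed.

(** Support in a coordinate cube passes directly to slices and matches the finite-measure set
    [box]. *)
Definition compactly_supported n (f : 'rV[R]_n -> R) := continuous f /\
  exists M, forall x, f x != 0 -> forall i, `|x ord0 i| <= M.

Lemma compactly_supported_bounded n (f : 'rV[R]_n -> R) : compactly_supported f ->
  exists K, forall x, `|f x| <= K.
Proof.
move=> [cf [M fM]].
have := @rV_compact R n (fun=> `[- M, M]%classic) (fun=> @segment_compact _ _ _).
move=> /(continuous_compact (continuous_subspaceT cf)) /compact_bounded[K [_ HK]].
exists (Num.max 0 (K + 1)) => x; have [->|fx0] := eqVneq (f x) 0.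
  by rewrite normr0 le_max lexx.
rewrite le_max; apply/orP; right; apply: HK; first by rewrite ltrDl.
by exists x => // i; rewrite /= in_itv/= -ler_norml; exact: fM.
Qed.

Lemma compactly_supported_integrable n (f : 'rV[R]_n -> R) : compactly_supported f ->
  (mu n).-integrable setT (fun t => (f (row_of_tuple t))%:E).
Proof.
move=> cf; have [K fK] := compactly_supported_bounded cf; have [cof [M fM]] := cf.
apply: (@bounded_support_integrable R _ _ (mu n) (box n M)
  (fun t : tup n => f (row_of_tuple t)) K).
- exact: measurable_box.
- exact: box_lty.
- exact: row_measurable.
- by move=> t; exact: fK.
- move=> t Bt; apply: contrapT => /eqP /fM H; apply: Bt => i.
  by have := H i; rewrite mxE.
Qed.

Definition cons_row n (a : R) (y : 'rV[R]_n) : 'rV[R]_n.+1 :=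
  \row_i (if unlift ord0 i is Some j then y ord0 j else a).

Lemma cons_row0 n a (y : 'rV[R]_n) : cons_row a y ord0 ord0 = a.
Proof. by rewrite mxE unlift_none. Qed.

Lemma cons_row_lift n a (y : 'rV[R]_n) j : cons_row a y ord0 (lift ord0 j) = y ord0 j.
Proof. by rewrite mxE liftK. Qed.

Lemma row_of_cons n a (t : n.-tuple R) :
  row_of_tuple [tuple of a :: t] = cons_row a (row_of_tuple t).
Proof.
apply/rowP => i; rewrite !mxE; case: unliftP => [j|] ->; first by rewrite tnthS mxE.
by rewrite tnth0.
Qed.

Lemma cons_row_continuousr n a : continuous (@cons_row n a).
Proof.
move=> y A /nbhs_ballP[e /= e0 eA]; apply/nbhs_ballP; exists e => //= z [_ yz].
apply: eA; split=> // i j; rewrite !mxE.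
by case: unliftP => [k|] _; [exact: yz|exact: ballxx].
Qed.

Lemma cons_row_continuousl n (y : 'rV[R]_n) : continuous (fun a : R => cons_row a y).
Proof.
move=> a A /nbhs_ballP[e /= e0 eA]; apply/nbhs_ballP; exists e => //= b ab.
apply: eA; split=> // i j; rewrite !mxE.
by case: unliftP => [k|] _; [exact: ballxx|exact: ab].
Qed.

Lemma compactly_supported_cons n a (f : 'rV[R]_n.+1 -> R) : compactly_supported f ->
  compactly_supported (fun y => f (cons_row a y)).
Proof.
move=> [cf [M fM]]; split.
  by move=> y; apply: continuous_comp; [exact: cons_row_continuousr|exact: cf].
exists M => y /fM H i; by have := H (lift ord0 i); rewrite cons_row_lift.
Qed.

Lemma compactly_supported_prod_integrable n (f : 'rV[R]_n.+1 -> R) :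
  compactly_supported f ->
  (lebesgue_measure \x mu n)%E.-integrable setT
    (fun p => (f (row_of_tuple (cons_pair p)))%:E).
Proof.
move=> cf; have [K fK] := compactly_supported_bounded cf; have [cof [M fM]] := cf.
apply: (@bounded_support_integrable R _ _ (lebesgue_measure \x mu n)%E
  (`[- M, M]%classic `*` box n M)
  (fun p => f (row_of_tuple (cons_pair p))) K).
- by apply: measurableX => //; exact: measurable_box.
- exact: box2_lty.
- apply: (@measurableT_comp _ _ _ _ _ _ (fun t : tup n.+1 => f (row_of_tuple t))).
    exact: row_measurable.
  exact: measurable_cons_pair.
- by move=> t; exact: fK.
- move=> p Bp; apply: contrapT => /eqP /fM H; apply: Bp.
  rewrite -box_preimage => i.
  by have := H i; rewrite mxE.
Qed.

Lemma integral_Rn_cons n (f : 'rV[R]_n.+1 -> R) : compactly_supported f ->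
  integral_Rn f = (\int[lebesgue_measure \x mu n]_p (f (row_of_tuple (cons_pair p)))%:E)%E.
Proof.
move=> cf; rewrite /integral_Rn.
transitivity (\int[pushforward (lebesgue_measure \x mu n)%E (@cons_pair R n)]_t
   (f (row_of_tuple t))%:E)%E.
  by apply: eq_measure_integral; [exact: measurable_cons_pair|].
rewrite integral_pushforward//.
- exact: measurable_cons_pair.
- by apply/measurable_EFinP; apply: row_measurable; exact: cf.1.
- exact: compactly_supported_prod_integrable.
Qed.

(** Both orders of integration are used: this one leaves a slice of one dimension less inside, for
    induction; [fubini_cons2] leaves a line inside, for the fundamental theorem of calculus. *)
Lemma fubini_cons1 n (f : 'rV[R]_n.+1 -> R) : compactly_supported f ->
  integral_Rn f = (\int[lebesgue_measure]_a integral_Rn (fun y => f (cons_row a y)))%E.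
Proof.
move=> cf; rewrite integral_Rn_cons//.
rewrite -(integral12_prod_meas1 (compactly_supported_prod_integrable cf)).
apply: eq_integral => a _; rewrite /integral_Rn; apply: eq_integral => t _ /=.
by rewrite /cons_pair /= row_of_cons.
Qed.

Lemma fubini_cons2 n (f : 'rV[R]_n.+1 -> R) : compactly_supported f ->
  integral_Rn f = (\int[mu n]_t \int[lebesgue_measure]_a
    (f (cons_row a (row_of_tuple t)))%:E)%E.
Proof.
move=> cf; rewrite integral_Rn_cons//.
rewrite -(integral21_prod_meas1 (compactly_supported_prod_integrable cf)).
apply: eq_integral => t _; apply: eq_integral => a _ /=.
by rewrite /cons_pair /= row_of_cons.
Qed.

End compact_support.

(** * Vanishing integrals of partial derivatives *)

Section divergence.
Context {R : realType}.

Lemma integral_line_derivative (h h' : R -> R) (M : R) :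
  (forall a : R, is_derive a 1 h (h' a)) -> continuous h' ->
  (forall a, M < `|a| -> h a = 0 /\ h' a = 0) ->
  (\int[lebesgue_measure]_a (h' a)%:E = 0)%E.
Proof.
move=> dh ch hM; pose M' := `|M| + 1.
have MM' : M < M' by rewrite /M' ltr_pwDr// ler_norm.
have M'0 : 0 < M' by rewrite /M' ltr_wpDl.
have ab : - M' < M' by rewrite (lt_trans _ M'0)// oppr_lt0.
have -> : (\int[lebesgue_measure]_a (h' a)%:E =
    \int[lebesgue_measure]_(a in `[(- M')%R, M']) (h' a)%:E)%E.
  rewrite [RHS]integral_mkcond; apply: eq_integral => a _; rewrite patchE.
  case: ifPn => // /negP aM; rewrite (hM a _).2//.
  apply: (lt_trans MM'); rewrite ltNge; apply/negP => aM'; apply: aM.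
  by rewrite inE/= in_itv/= -ler_norml.
rewrite (@continuous_FTC2 _ h' h _ _ ab).
- rewrite (hM M' _).1 ?(hM (- M') _).1 ?normrN ?gtr0_norm//.
  by rewrite subee.
- exact: continuous_subspaceT.
- split.
  + by move=> x _; have [] := dh x.
  + by apply: cvg_at_right_filter; exact: (der_continuous (dh _)).
  + by apply: cvg_at_left_filter; exact: (der_continuous (dh _)).
- by move=> x _; rewrite derive1E; have [_ ->] := dh x.
Qed.

Lemma cons_row_der_lift n (f : 'rV[R]_n.+1 -> R) (a : R) (y : 'rV[R]_n) j (d : R) :
  is_derive (cons_row a y) (basis_vector (lift ord0 j)) f d ->
  is_derive y (basis_vector j) (fun z => f (cons_row a z)) d.
Proof.
move=> [df <-].
have E : (fun h : R => h^-1 *: (f (cons_row a (h *: basis_vector j + y)) - f (cons_row a y))) =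
    (fun h : R => h^-1 *: (f (h *: basis_vector (lift ord0 j) + cons_row a y)
      - f (cons_row a y))).
  apply/funext => h; congr (_ *: (f _ - _)); apply/rowP => i; rewrite !mxE.
  case: (unliftP ord0 i) => [k|] ->; last by rewrite (negbTE (neq_lift _ _)) andbF mulr0 add0r.
  by rewrite !mxE (inj_eq lift_inj).
by apply: DeriveDef; rewrite /derivable /derive /= E.
Qed.

Lemma cons_row_der0 n (f : 'rV[R]_n.+1 -> R) (a : R) (y : 'rV[R]_n) (d : R) :
  is_derive (cons_row a y) (basis_vector ord0) f d ->
  is_derive a 1 (fun b => f (cons_row b y)) d.
Proof.
move=> [df <-].
have E : (fun h : R => h^-1 *: (f (cons_row (h *: 1 + a) y) - f (cons_row a y))) =
    (fun h : R => h^-1 *: (f (h *: basis_vector ord0 + cons_row a y) - f (cons_row a y))).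
  apply/funext => h; congr (_ *: (f _ - _)); apply/rowP => i; rewrite !mxE.
  case: (unliftP ord0 i) => [k|] ->; last by rewrite !eqxx/= mulr1 [h%:A]mulr1.
  by rewrite [lift ord0 k == ord0]eq_sym (negbTE (neq_lift _ _)) andbF mulr0 add0r.
by apply: DeriveDef; rewrite /derivable /derive /= E.
Qed.

(** By induction on the dimension: a direction other than the first acts inside the slices, while
    the first one gives derivatives along lines. In dimension 0 there is no direction. *)
Lemma integral_pderiv_eq0 n (f g : 'rV[R]_n -> R) i :
  compactly_supported f -> compactly_supported g ->
  (forall x, is_derive x (basis_vector i) f (g x)) -> integral_Rn g = 0%E.
Proof.
elim: n f g i => [|n IH] f g i cf cg dfg; first by case: i {dfg}.
case: (unliftP ord0 i) => [j|] ij; rewrite {i}ij in dfg.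
  rewrite fubini_cons1// integral0_eq// => a _.
  apply: (IH (fun y => f (cons_row a y)) _ j); try exact: compactly_supported_cons.
  by move=> y; apply: cons_row_der_lift.
rewrite fubini_cons2// integral0_eq// => t _.
have [_ [M fM]] := cf; have [cog [M2 gM]] := cg.
apply: (@integral_line_derivative (fun a => f (cons_row a (row_of_tuple t))) _ (Num.max M M2)).
- by move=> a; apply: cons_row_der0.
- by move=> a; apply: continuous_comp; [exact: cons_row_continuousl|exact: cog].
- move=> a; rewrite gt_max => /andP[Ma M2a]; split.
  + apply/eqP; apply: contraTT Ma => /fM/(_ ord0); rewrite cons_row0.
    by rewrite -leNgt.
  + apply/eqP; apply: contraTT M2a => /gM/(_ ord0); rewrite cons_row0.
    by rewrite -leNgt.
Qed.

End divergence.

Section integral_functional.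
Context {R : realType} {n : nat}.
Implicit Types f g : 'rV[R]_n -> R.

Definition Rintegral_Rn f : R := fine (integral_Rn f).

Lemma integral_RnE f : compactly_supported f -> integral_Rn f = (Rintegral_Rn f)%:E.
Proof.
move=> cf; rewrite /Rintegral_Rn fineK//.
exact: integrable_fin_num (compactly_supported_integrable cf).
Qed.

Lemma compactly_supportedD f g : compactly_supported f -> compactly_supported g ->
  compactly_supported (fun x => f x + g x).
Proof.
move=> [cf [M fM]] [cg [M' gM]]; split.
  by move=> x; apply: for_continuousD; [exact: cf|exact: cg].
exists (Num.max M M') => x fg i; rewrite le_max.
have [fx|fx] := eqVneq (f x) 0; last by rewrite fM.
by rewrite gM ?orbT//; apply: contraNN fg => /eqP gx; rewrite fx gx addr0.
Qed.

Lemma compactly_supportedM f g : compactly_supported f -> continuous g ->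
  compactly_supported (fun x => g x * f x).
Proof.
move=> [cf [M fM]] cg; split.
  by move=> x; apply: for_continuousM; [exact: cg|exact: cf].
by exists M => x fg; apply: fM; apply: contraNN fg => /eqP ->; rewrite mulr0.
Qed.

Lemma compactly_supported0 : compactly_supported (fun _ : 'rV[R]_n => 0).
Proof. by split; [exact: cst_continuous|exists 0 => x; rewrite eqxx]. Qed.

Lemma compactly_supported_sum (I : Type) (s : seq I) (F : I -> 'rV[R]_n -> R) :
  (forall i, compactly_supported (F i)) ->
  compactly_supported (fun x => \sum_(i <- s) F i x).
Proof.
move=> cF; elim: s => [|i s IH].
  by under eq_fun do rewrite big_nil; exact: compactly_supported0.
by under eq_fun do rewrite big_cons; exact: compactly_supportedD.
Qed.

Lemma Rintegral_RnD f g : compactly_supported f -> compactly_supported g ->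
  Rintegral_Rn (fun x => f x + g x) = Rintegral_Rn f + Rintegral_Rn g.
Proof.
move=> cf cg; apply: EFin_inj; rewrite EFinD -!integral_RnE//; last exact: compactly_supportedD.
rewrite /integral_Rn -integralD//; last exact: (compactly_supported_integrable cg).
exact: (compactly_supported_integrable cf).
Qed.

Lemma Rintegral_RnZ (c : R) f : compactly_supported f ->
  Rintegral_Rn (fun x => c * f x) = c * Rintegral_Rn f.
Proof.
move=> cf; apply: EFin_inj; rewrite EFinM -!integral_RnE//; last first.
  by apply: compactly_supportedM => //; exact: cst_continuous.
rewrite /integral_Rn -integralZl//; exact: (compactly_supported_integrable cf).
Qed.

Lemma Rintegral_Rn_sum (I : Type) (s : seq I) (F : I -> 'rV[R]_n -> R) :
  (forall i, compactly_supported (F i)) ->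
  Rintegral_Rn (fun x => \sum_(i <- s) F i x) = \sum_(i <- s) Rintegral_Rn (F i).
Proof.
move=> cF; elim: s => [|i s IH].
  rewrite big_nil -[RHS](mul0r (Rintegral_Rn (fun=> 0))).
  rewrite -Rintegral_RnZ; last exact: compactly_supported0.
  by congr Rintegral_Rn; apply/funext => x; rewrite big_nil mul0r.
rewrite big_cons -IH -Rintegral_RnD//; last exact: compactly_supported_sum.
by congr Rintegral_Rn; apply/funext => x; rewrite big_cons.
Qed.

Lemma Rintegral_Rn_le f g : compactly_supported f -> compactly_supported g ->
  (forall x, f x <= g x) -> Rintegral_Rn f <= Rintegral_Rn g.
Proof.
move=> cf cg fg; rewrite -lee_fin -!integral_RnE//.
rewrite /integral_Rn; apply: le_integral => //.
- exact: (compactly_supported_integrable cf).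
- exact: (compactly_supported_integrable cg).
- by move=> t _; rewrite lee_fin.
Qed.

Lemma Rintegral_Rn_pderiv f g i : compactly_supported f -> compactly_supported g ->
  (forall x, is_derive x (basis_vector i) f (g x)) -> Rintegral_Rn g = 0.
Proof.
by move=> cf cg dfg; rewrite /Rintegral_Rn (integral_pderiv_eq0 cf cg dfg).
Qed.

End integral_functional.

(** * A Hardy-Rellich inequality *)

Section mixed_derivatives.
Context {R : realType} {n : nat}.
Implicit Types (f : 'rV[R]_n -> R) (x y : 'rV[R]_n).
Local Notation e := (@basis_vector R n).

Lemma line_der f y i (t d : R) : is_derive (t *: e i + y) (e i) f d ->
  is_derive t 1 (fun s => f (s *: e i + y)) d.
Proof.
move=> [df <-].
have E : (fun h : R => h^-1 *: (f ((h *: 1 + t) *: e i + y) - f (t *: e i + y))) =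
    (fun h => h^-1 *: (f (h *: e i + (t *: e i + y)) - f (t *: e i + y))).
  by apply/funext => h; rewrite [h *: 1]mulr1 scalerDl addrA.
by apply: DeriveDef; rewrite /derivable /derive /= E.
Qed.

(** The second difference is symmetric in [i] and [j]; for small [s], using it in both orders makes
    the two mixed derivatives agree at nearby points, which is Schwarz's theorem. *)
Lemma second_difference f x i j (s : R) : Ck 2 setT f -> 0 < s ->
  exists t1 t2, [/\ 0 < t1 < s, 0 < t2 < s &
    f (s *: e i + (s *: e j + x)) - f (s *: e i + x) - f (s *: e j + x) + f x =
    s * s * pderiv j (pderiv i f) (t1 *: e i + (t2 *: e j + x))].
Proof.
move=> Cf s0.
have df y k : is_derive y (e k) f (pderiv k f y) := Ck_derive k Cf I.
have ddf y k l : is_derive y (e l) (pderiv k f) (pderiv l (pderiv k f) y).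
  exact: (Ck_derive l (Ck_pderiv k Cf) I).
pose phi (t : R) := f (t *: e i + (s *: e j + x)) - f (t *: e i + x).
pose phi' (t : R) := pderiv i f (t *: e i + (s *: e j + x)) - pderiv i f (t *: e i + x).
have [|t1 t1s E1] := @mean_value R phi phi' 0 s s0.
  by move=> t _; apply: derB; apply: line_der; exact: df.
pose psi (t : R) := pderiv i f (t *: e j + (t1 *: e i + x)).
have [|t2 t2s E2] := @mean_value R psi
    (fun t => pderiv j (pderiv i f) (t *: e j + (t1 *: e i + x))) 0 s s0.
  by move=> t _; apply: line_der; exact: ddf.
exists t1, t2; split=> //; move: E1 E2; rewrite /phi /phi' /psi !scale0r !add0r !subr0.
rewrite [t1 *: e i + (s *: e j + x)]addrCA => E1 E2.
rewrite E2 in E1; rewrite [t1 *: e i + (t2 *: e j + x)]addrCA.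
by rewrite [RHS]mulrC mulrA -E1; ring.
Qed.

Lemma pderivC f i j : Ck 2 setT f -> pderiv i (pderiv j f) = pderiv j (pderiv i f).
Proof.
move=> Cf; apply/funext => x.
have cont k l : {for x, continuous (pderiv k (pderiv l f))}.
  by apply: (Ck_continuous (k := 0) (O := setT)) => //; do 2 apply: Ck_pderiv.
apply/eqP; rewrite -subr_eq0 -normr_le0; apply/ler_addgt0Pl => d d0; rewrite addr0.
have d2 : 0 < d / 2 by rewrite divr_gt0.
move: (cont i j) => /cvgrPdist_lt/(_ _ d2) /nbhs_ballP[r1 /= r10 H1].
move: (cont j i) => /cvgrPdist_lt/(_ _ d2) /nbhs_ballP[r2 /= r20 H2].
(* Half the radius, because for equal directions the two displacements add up in one coordinate. *)
pose s := Num.min r1 r2 / 2; have r0 : 0 < Num.min r1 r2 by rewrite lt_min r10.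
have s0 : 0 < s by rewrite divr_gt0.
have close (t1 t2 r : R) k l : 0 < t1 < s -> 0 < t2 < s -> Num.min r1 r2 <= r ->
    ball x r (t1 *: e k + (t2 *: e l + x)).
  move=> /andP[t10 t1s] /andP[t20 t2s] rr; split; first exact: lt_le_trans rr.
  move=> a b; rewrite /ball /= !mxE addrA opprD addrCA subrr addr0 normrN.
  apply: lt_le_trans rr; rewrite [ltRHS](splitr (Num.min r1 r2)).
  apply: (le_lt_trans (ler_normD _ _)); apply: ltrD; rewrite normrM gtr0_norm//.
    by apply: le_lt_trans t1s; rewrite ler_piMr ?(ltW t10)// normr_nat lern1 leq_b1.
  by apply: le_lt_trans t2s; rewrite ler_piMr ?(ltW t20)// normr_nat lern1 leq_b1.
have [t1 [t2 [t1s t2s E1]]] := second_difference x i j Cf s0.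
have [t3 [t4 [t3s t4s E2]]] := second_difference x j i Cf s0.
have E : pderiv i (pderiv j f) (t3 *: e j + (t4 *: e i + x)) =
    pderiv j (pderiv i f) (t1 *: e i + (t2 *: e j + x)).
  have ss : s * s != 0 by rewrite mulf_neq0// gt_eqF.
  apply: (mulfI ss); apply: (etrans (esym E2)); apply: (etrans _ E1).
  have -> : s *: e j + (s *: e i + x) = s *: e i + (s *: e j + x) by exact: addrCA.
  by congr (_ + f x); exact: addrAC.
have := H1 _ (close t3 t4 r1 j i t3s t4s ltac:(by rewrite ge_min lexx)).
have := H2 _ (close t1 t2 r2 i j t1s t2s ltac:(by rewrite ge_min lexx orbT)).
rewrite /= E; set A := pderiv j (pderiv i f) (_ + _) => h2 h1.
apply: (le_trans (ler_distD A _ _)); rewrite (splitr d).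
by apply: lerD; [exact: (ltW h1)|rewrite distrC; exact: (ltW h2)].
Qed.

End mixed_derivatives.

Local Opaque Rintegral_Rn.

Section rellich.
Context {R : realType} {N : nat} (C : set 'rV[R]_N.+1).
Hypotheses (closedC : closed C)
  (boundedC : exists M, forall x, C x -> forall i, `|x ord0 i| <= M)
  (farC : forall x, C x -> 1 <= sqnorm x).
Local Notation n := N.+1.
Local Notation I := (@Rintegral_Rn R n).
Local Notation lap := (@laplacian R n).
Implicit Types (f g h : 'rV[R]_n -> R) (x : 'rV[R]_n) (i j : 'I_n).

(** Support is measured by one fixed closed set, so that differentiation preserves the class and all
    derivatives stay at the distance from the origin that [hardy] uses. *)
Definition smooth_in g := (forall k, Ck k setT g) /\ (forall x, ~ C x -> g x = 0).

Let smooth_der g i x : smooth_in g -> is_derive x (basis_vector i) g (pderiv i g x).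
Proof. by move=> [Cg _]; exact: (Ck_derive i (Cg 1%N)). Qed.

Let smooth_cont g : smooth_in g -> continuous g.
Proof. by move=> [Cg _] x; exact: (Ck_continuous (Cg 0%N)). Qed.

Lemma smooth_in_pderiv g i : smooth_in g -> smooth_in (pderiv i g).
Proof.
move=> [Cg g0]; split=> [k|x Cx]; first exact: (Ck_pderiv i (Cg k.+1)).
rewrite (pderiv_eq (g := fun=> 0) i (closed_openC closedC) Cx g0).
by have [_] := der_cst x (basis_vector i) (0 : R).
Qed.

Lemma smooth_in_laplacian g : smooth_in g -> smooth_in (lap g).
Proof.
move=> Sg; split=> [k|x Cx]; first exact: (Ck_laplacian openT (Sg.1 _)).
rewrite /laplacian big1// => i _.
by have [_ ->] := smooth_in_pderiv i (smooth_in_pderiv i Sg).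
Qed.

Lemma smooth_in_iter_laplacian k g : smooth_in g -> smooth_in (iter k lap g).
Proof. by move=> Sg; elim: k => // k IH; exact: smooth_in_laplacian. Qed.

Lemma smooth_in_cc g : smooth_in g -> compactly_supported g.
Proof.
move=> Sg; split; first exact: smooth_cont.
have [M CM] := boundedC; exists M => x gx; apply: CM; apply: contrapT => Cx.
by move: gx; rewrite Sg.2// eqxx.
Qed.

Let cc_mul f g : continuous f -> smooth_in g -> compactly_supported (fun x => f x * g x).
Proof. by move=> cf Sg; apply: compactly_supportedM => //; exact: smooth_in_cc. Qed.

Let cc_sqr g : smooth_in g -> compactly_supported (fun x => g x ^+ 2).
Proof.
move=> Sg; under eq_fun do rewrite expr2.
by apply: cc_mul => //; exact: smooth_cont.
Qed.

Lemma integration_by_parts_Rn g h i : smooth_in g -> smooth_in h ->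
  I (fun x => pderiv i g x * h x) = - I (fun x => g x * pderiv i h x).
Proof.
move=> Sg Sh; have Sg' := smooth_in_pderiv i Sg; have Sh' := smooth_in_pderiv i Sh.
have c1 : compactly_supported (fun x => g x * pderiv i h x).
  by apply: cc_mul => //; exact: smooth_cont.
have c2 : compactly_supported (fun x => pderiv i g x * h x).
  by apply: cc_mul => //; exact: smooth_cont.
apply/eqP; rewrite -addr_eq0 addrC -Rintegral_RnD//; apply/eqP.
apply: (@Rintegral_Rn_pderiv R n (fun x => g x * h x) _ i).
- by apply: cc_mul => //; exact: smooth_cont.
- exact: compactly_supportedD.
- by move=> x; apply: derM; exact: smooth_der.
Qed.

Lemma integral_sqr_laplacian g : smooth_in g ->
  I (fun x => lap g x ^+ 2) = \sum_i \sum_j I (fun x => pderiv i (pderiv j g) x ^+ 2).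
Proof.
move=> Sg; have Sd i := smooth_in_pderiv i Sg.
have Sdd i j := smooth_in_pderiv i (Sd j).
have cdd i j : compactly_supported (fun x => pderiv i (pderiv i g) x * pderiv j (pderiv j g) x).
  by apply: cc_mul => //; exact: smooth_cont.
have -> : (fun x => lap g x ^+ 2) =
    (fun x => \sum_i \sum_j pderiv i (pderiv i g) x * pderiv j (pderiv j g) x).
  apply/funext => x; rewrite expr2 {1}/laplacian mulr_suml.
  by apply: eq_bigr => i _; rewrite mulr_sumr.
rewrite Rintegral_Rn_sum; last by move=> i; apply: compactly_supported_sum.
apply: eq_bigr => i _; rewrite Rintegral_Rn_sum; last exact: cdd.
apply: eq_bigr => j _.
have C2 h : smooth_in h -> Ck 2 setT h by case.
(* [e1] moves one [d_i] and [e2] moves one [d_j]; the two signs cancel, and symmetry of mixed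
   derivatives leaves the square of [d_i d_j g]. *)
have e1 := integration_by_parts_Rn i (Sd i) (Sdd j j).
have e2 := integration_by_parts_Rn j (Sdd i j) (Sd i).
have e3 : (fun x => pderiv i g x * pderiv i (pderiv j (pderiv j g)) x) =
    (fun x => pderiv j (pderiv i (pderiv j g)) x * pderiv i g x).
  by apply/funext => x; rewrite (pderivC i j (C2 _ (Sd j))) mulrC.
have e4 : (fun x => pderiv i (pderiv j g) x * pderiv j (pderiv i g) x) =
    (fun x => pderiv i (pderiv j g) x ^+ 2).
  by apply/funext => x; rewrite (pderivC j i (C2 _ Sg)) expr2.
apply: (etrans e1); apply: (etrans (congr1 (fun h => - I h) e3)).
apply: (etrans (congr1 -%R e2)); apply: (etrans (opprK _)).
exact: (congr1 (fun h => I h) e4).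
Qed.

Lemma laplacian_pderivC g i : smooth_in g -> lap (pderiv i g) = pderiv i (lap g).
Proof.
move=> Sg; apply/funext => x.
have C2 h : smooth_in h -> Ck 2 setT h by case.
have Sd j := smooth_in_pderiv j Sg.
have H j : is_derive x (basis_vector i) (pderiv j (pderiv j g))
    (pderiv i (pderiv j (pderiv j g)) x).
  by apply: smooth_der; exact: smooth_in_pderiv.
have [_ E] := @is_derive_sum _ _ _ n (fun j => pderiv j (pderiv j g)) x (basis_vector i) _ H.
have lapE : lap g = \sum_(j < n) (pderiv j (pderiv j g) : 'rV[R]_n -> R).
  by apply/funext => y; rewrite fct_sumE; apply: eq_bigr.
apply: (etrans _ (esym (congr1 (fun h => 'D_(basis_vector i) h x) lapE))).
apply: (etrans _ (esym E)); apply: eq_bigr => j _.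
by rewrite (pderivC j i (C2 _ Sg)) (pderivC j i (C2 _ (Sd j))).
Qed.

Lemma iter_laplacian_pderivC k g i : smooth_in g ->
  iter k lap (pderiv i g) = pderiv i (iter k lap g).
Proof.
move=> Sg; elim: k => // k IH; rewrite !iterS IH.
by apply: laplacian_pderivC; exact: smooth_in_iter_laplacian.
Qed.

(* Used instead of [|x|^-2], which is singular at the origin. *)
Definition weight x : R := (1 + sqnorm x)^-1.

Let q0 x : 0 < 1 + sqnorm x. Proof. by rewrite ltr_pwDl// sqnorm_ge0. Qed.

Lemma weight_gt0 x : 0 < weight x. Proof. by rewrite invr_gt0. Qed.

Lemma weight_le1 x : weight x <= 1.
Proof. by rewrite invf_le1// lerDl sqnorm_ge0. Qed.

Let weight_continuous : continuous weight.
Proof.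
move=> x; apply: (@for_continuousV _ _ (fun y => 1 + sqnorm y)).
  by rewrite gt_eqF.
by apply: for_continuousD; [exact: for_continuous_cst|exact: sqnorm_continuous].
Qed.

Let weightX_continuous (k : nat) : continuous (fun x => weight x ^+ k).
Proof. by move=> x; apply: for_continuousX; exact: weight_continuous. Qed.

Let weight_der x i k : is_derive x (basis_vector i) (fun y => weight y ^+ k)
  (- (2 * k%:R * x ord0 i * weight x ^+ k.+1)).
Proof.
have d := @derV _ _ (fun y => 1 + sqnorm y) _ _ _ (lt0r_neq0 (q0 x))
  (derD (der_cst x (basis_vector i) 1) (sqnorm_der x i)).
apply: (der_eq _ (derX k d)); rewrite -/(weight x) add0r -exprVn -/(weight x).
by case: k => [|k]; rewrite /= ?exprS; ring.
Qed.

(* The divergence of [weight^j g^2 x] has integral zero. Large exponents [j] are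
   what makes the constant positive in every dimension. *)
Lemma hardy (j : nat) g : (n < j)%N -> smooth_in g ->
  I (fun x => weight x ^+ j * g x ^+ 2) <=
  4 * \sum_i I (fun x => weight x ^+ j.-1 * pderiv i g x ^+ 2).
Proof.
move=> nj Sg; have Sd i := smooth_in_pderiv i Sg.
have cg := smooth_cont Sg.
have cW f k : smooth_in f -> compactly_supported (fun x => weight x ^+ k * f x ^+ 2).
  move=> Sf; apply: (@compactly_supportedM R n (fun x => f x ^+ 2) (fun x => weight x ^+ k)).
    exact: cc_sqr.
  exact: weightX_continuous.
pose F i x := x ord0 i * (weight x ^+ j * g x ^+ 2).
pose F' i x := (x ord0 i * (- (2 * j%:R * x ord0 i * weight x ^+ j.+1) * g x
  + weight x ^+ j * (2 * pderiv i g x)) + weight x ^+ j * g x) * g x.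
have dF i x : is_derive x (basis_vector i) (F i) (F' i x).
  have dg2 := derX 2 (smooth_der i x Sg).
  apply: (der_eq _ (derM (coord_der x i i) (derM (weight_der x i j) dg2))).
  by rewrite eqxx /F' /= expr1; ring.
have cF i : compactly_supported (F i).
  by apply: compactly_supportedM (cW _ _ Sg) _ => x; exact: coord_cont.
have cF' i : compactly_supported (F' i).
  apply: cc_mul => // x.
  have cx : {for x, continuous (fun y : 'rV[R]_n => y ord0 i)} := @coord_cont R n x i.
  have cw k : {for x, continuous (fun y => weight y ^+ k)} by exact: weightX_continuous.
  have cgx : {for x, continuous g} by exact: cg.
  have cdx : {for x, continuous (pderiv i g)} by exact: (smooth_cont (Sd i)).
  have cc (c : R) : {for x, continuous (fun _ : 'rV[R]_n => c)} by exact: for_continuous_cst.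
  apply: (for_continuousD _ (for_continuousM (cw j) cgx)).
  apply: (for_continuousM cx (for_continuousD (for_continuousM (for_continuousN _) cgx) _)).
    exact: (for_continuousM (for_continuousM (cc (2 * j%:R)) cx) (cw j.+1)).
  exact: (for_continuousM (cw j) (for_continuousM (cc 2) cdx)).
have IF : I (fun x => \sum_i F' i x) = 0.
  by rewrite Rintegral_Rn_sum// big1// => i _; exact: Rintegral_Rn_pderiv (cF i) (cF' i) (dF i).
have cD i : compactly_supported (fun x => weight x ^+ j.-1 * pderiv i g x ^+ 2) := cW _ _ (Sd i).
have cS := compactly_supported_sum (index_enum 'I_n) cD.
have cG := cW g j Sg.
have cFs := compactly_supported_sum (index_enum 'I_n) cF'.
(* The pointwise form of the inequality: the multiple of the divergence [\sum_i F' i x] integrates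
   to zero by [IF]. *)
have pw x : weight x ^+ j * g x ^+ 2 <=
    (- 2) * (\sum_i F' i x) + 4 * \sum_i (weight x ^+ j.-1 * pderiv i g x ^+ 2).
  have [Cx|/Sg.2 gx] := pselect (C x); last first.
    rewrite gx expr0n mulr0 [X in _ * X + _]big1 ?mulr0 ?add0r; last by move=> i _; rewrite /F' gx mulr0.
    rewrite mulr_ge0// sumr_ge0// => i _.
    by rewrite mulr_ge0 ?sqr_ge0// exprn_ge0// ltW// weight_gt0.
  have s1 := farC Cx; set s := sqnorm x in s1 *; set p := weight x.
  have ps : p * (1 + s) = 1 by rewrite /p /weight mulVf// gt_eqF.
  have p0 : 0 < p := weight_gt0 x.
  have pj0 : 0 < p ^+ j by rewrite exprn_gt0.
  have pjE : p ^+ j.-1 = p ^+ j * (1 + s).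
    by rewrite -{2}(ltn_predK nj) exprSr -mulrA ps mulr1.
  have jn : n%:R + 1 <= j%:R :> R by rewrite natr1 ler_nat.
  set P := p ^+ j in pj0 pjE *.
  have amgm i : P * ((4 * j%:R - 1) * p * g x ^+ 2 * x ord0 i ^+ 2 - 2 * g x ^+ 2) <=
      - 2 * F' i x + 4 * (p ^+ j.-1 * pderiv i g x ^+ 2).
    rewrite /F' -/p (exprS p j) -/P pjE -subr_ge0.
    (* The cross term is completed to a square using [p (1 + s) = 1]. *)
    rewrite (_ : _ - _ = P * (1 + s) * (2 * pderiv i g x - p * x ord0 i * g x) ^+ 2
      + P * (1 - p * (1 + s)) * (p * x ord0 i ^+ 2 * g x ^+ 2 - 4 * x ord0 i * pderiv i g x * g x)).
      rewrite ps subrr mulr0 mul0r addr0 mulr_ge0 ?sqr_ge0// mulr_ge0 ?ltW//.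
      exact: q0.
    ring.
  apply: (@le_trans _ _ (\sum_i (- 2 * F' i x + 4 * (p ^+ j.-1 * pderiv i g x ^+ 2)))); last first.
    by rewrite big_split/= -!mulr_sumr.
  apply: (le_trans _ (ler_sum _ (fun i _ => amgm i))).
  rewrite -mulr_sumr ler_pM2l// sumrB -mulr_sumr sumr_const card_ord.
  rewrite -[_ *+ n]mulr_natr -/(sqnorm x) -/s.
  have ps2 : 1 / 2 <= p * s.
    have p2 : p <= 1 / 2.
      by rewrite ler_pdivlMr// -[leRHS]ps ler_pM2l// lerD2l.
    by have := ps; rewrite mulrDr mulr1; lra.
  have g2 : 0 <= g x ^+ 2 := sqr_ge0 _.
  (* From [s >= 1] comes [p s >= 1 / 2]; with [j >= n + 1] the coefficient exceeds by at least 1 the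
     [2 n] produced by the divergence of [x]. *)
  have J : 2 * n%:R + 1 <= (4 * j%:R - 1) * (p * s).
    apply: (@le_trans _ _ ((4 * j%:R - 1) * (1 / 2))); first by lra.
    by apply: ler_wpM2l => //; have : 0 <= n%:R :> R by []; lra.
  by move: (ler_wpM2r g2 J) => H; lra.
have I2 := Rintegral_Rn_le cG _ pw.
have c1 := compactly_supportedM cFs (@cst_continuous _ _ (- 2 : R)).
have c2 := compactly_supportedM cS (@cst_continuous _ _ (4 : R)).
apply: (le_trans (I2 (compactly_supportedD c1 c2))).
have e1 := Rintegral_RnD c1 c2.
have e2 := Rintegral_RnZ (- 2) cFs.
have e3 := Rintegral_RnZ 4 cS.
have e4 := Rintegral_Rn_sum (index_enum 'I_n) cD.
rewrite le_eqVlt; apply/orP; left; apply/eqP; apply: (etrans e1).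
apply: (etrans (f_equal2 +%R e2 e3)).
apply: (etrans (f_equal2 (fun a b => - 2 * a + 4 * b) IF e4)).
by rewrite mulr0 add0r.
Qed.

Lemma weight_sqr_cc k g : smooth_in g -> compactly_supported (fun x => weight x ^+ k * g x ^+ 2).
Proof.
move=> Sg; apply: (@compactly_supportedM R n (fun x => g x ^+ 2) (fun x => weight x ^+ k)).
  exact: cc_sqr.
exact: weightX_continuous.
Qed.

(** Two Hardy steps lower the exponent from [n + 2 k + 2] to [n + 2 k], where the induction
    hypothesis applies to the second derivatives of [g]; these are reassembled by
    [integral_sqr_laplacian] for [Delta^k g]. Ending at [n] keeps every exponent used in [hardy]
    above [n]. *)
Lemma rellich k g : smooth_in g ->
  I (fun x => weight x ^+ (n + k.*2) * g x ^+ 2) <=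
  4 ^+ k.*2 * I (fun x => iter k lap g x ^+ 2).
Proof.
elim: k g => [|k IH] g Sg.
  rewrite addn0 expr0 mul1r; apply: Rintegral_Rn_le; [exact: weight_sqr_cc|exact: cc_sqr|].
  move=> x; rewrite ler_piMl ?sqr_ge0// exprn_ile1 ?weight_le1// ltW//.
  exact: weight_gt0.
have Sd j := smooth_in_pderiv j Sg; have Sdd i j := smooth_in_pderiv i (Sd j).
have Sk := smooth_in_iter_laplacian k Sg.
have nk l : (n < (n + l).+1)%N by rewrite ltnS leq_addr.
rewrite doubleS !addnS.
apply: (le_trans (hardy (leqW (nk k.*2)) Sg)).
apply: (@le_trans _ _ (4 * \sum_j (4 * \sum_i
    I (fun x => weight x ^+ (n + k.*2) * pderiv i (pderiv j g) x ^+ 2)))).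
  apply: ler_wpM2l => //; apply: ler_sum => j _.
  exact: (hardy (nk k.*2) (Sd j)).
apply: (@le_trans _ _ (4 * \sum_j (4 * \sum_i
    (4 ^+ k.*2 * I (fun x => iter k lap (pderiv i (pderiv j g)) x ^+ 2))))).
  apply: ler_wpM2l => //; apply: ler_sum => j _; apply: ler_wpM2l => //.
  by apply: ler_sum => i _; exact: IH.
rewrite le_eqVlt; apply/orP; left; apply/eqP.
have e := integral_sqr_laplacian Sk; rewrite exchange_big in e.
apply: (etrans _ (esym (congr1 (fun a => 4 ^+ (k.*2).+2 * a) e))).
rewrite !exprS -!mulrA; congr (_ * _).
rewrite !mulr_sumr; apply: eq_bigr => j _; rewrite !mulr_sumr.
apply: eq_bigr => i _; congr (_ * (_ * _)); congr I; apply/funext => x.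
by rewrite (iter_laplacian_pderivC k i (Sd j)) (iter_laplacian_pderivC k j Sg).
Qed.

(** A last Hardy step accounts for the gradient left over when [m] is odd: for [k = (m - 1) / 2] the
    exponent is [n + m] and the constant [4 ^+ m], a factor 4 for each of [m] derivatives. *)
Lemma rellich_gradient k g : smooth_in g ->
  I (fun x => weight x ^+ (n + k.*2).+1 * g x ^+ 2) <=
  4 ^+ (k.*2).+1 * I (sqnorm_grad (iter k lap g)).
Proof.
move=> Sg; have Sd j := smooth_in_pderiv j Sg.
have Sk := smooth_in_iter_laplacian k Sg.
have nk : (n < (n + k.*2).+1)%N by rewrite ltnS leq_addr.
apply: (le_trans (hardy nk Sg)).
apply: (@le_trans _ _ (4 * \sum_i (4 ^+ k.*2 *
    I (fun x => iter k lap (pderiv i g) x ^+ 2)))).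
  by apply: ler_wpM2l => //; apply: ler_sum => i _; exact: rellich (Sd i).
rewrite le_eqVlt; apply/orP; left; apply/eqP.
have cd i : compactly_supported (fun x => pderiv i (iter k lap g) x ^+ 2).
  by apply: cc_sqr; exact: smooth_in_pderiv.
have e := Rintegral_Rn_sum (index_enum 'I_n) cd.
apply: (etrans _ (esym (congr1 (fun a => 4 ^+ (k.*2).+1 * a) e))).
rewrite exprS -mulrA; congr (_ * _); rewrite mulr_sumr; apply: eq_bigr => i _.
congr (_ * _); congr I; apply/funext => x.
by rewrite (iter_laplacian_pderivC k i Sg).
Qed.

Lemma sqnorm_grad_cc k g : smooth_in g -> compactly_supported (sqnorm_grad (iter k lap g)).
Proof.
move=> Sg; apply: compactly_supported_sum => i; apply: cc_sqr.
by apply: smooth_in_pderiv; exact: smooth_in_iter_laplacian.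
Qed.

End rellich.

(** * Comparison of weights and stability *)

Lemma exp_dominates_power {R : realType} (e : R) (J m : nat) : 0 < e ->
  exists R0, 1 <= R0 /\
    forall r, R0 <= r -> 4 ^+ m * (1 + r ^+ 2) ^+ J <= expR (e * r ^+ 2).
Proof.
(* The exponential is split into [J.+1] equal factors, each at least
   [1 + e r^2 / (J + 1) >= d (1 + r^2)]; the spare factor [1 + r^2 >= r] absorbs
   [4 ^+ m / d ^+ J.+1]. *)
move=> e0; pose d : R := Num.min 1 (e / J.+1%:R).
have d0 : 0 < d by rewrite lt_min ltr01 divr_gt0// ltr0n.
have [d1 dJ] : d <= 1 /\ d <= e / J.+1%:R by rewrite /d !ge_min !lexx orbT.
exists (Num.max 1 (4 ^+ m / d ^+ J.+1)); split; first by rewrite le_max lexx.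
move=> r; rewrite ge_max => /andP[r1 rd].
have r2 : r <= 1 + r ^+ 2 by nra.
have y0 : 0 <= 1 + r ^+ 2 by rewrite addr_ge0 ?sqr_ge0.
have E : expR (e * r ^+ 2) = expR (e / J.+1%:R * r ^+ 2) ^+ J.+1.
  by rewrite -expRM_natl; congr expR; rewrite mulrA [_ * (e / _)]mulrC divfK// pnatr_eq0.
rewrite E; apply: (@le_trans _ _ ((d * (1 + r ^+ 2)) ^+ J.+1)); last first.
  apply: lerXn2r; rewrite ?nnegrE ?expR_ge0 ?mulr_ge0 ?(ltW d0)//.
  apply: le_trans (expR_ge1Dx _); rewrite mulrDr mulr1 lerD//.
  by rewrite ler_wpM2r// sqr_ge0.
rewrite exprMn (exprS (1 + r ^+ 2)) mulrA; apply: ler_wpM2r; first by rewrite exprn_ge0.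
move: rd; rewrite ler_pdivrMr ?exprn_gt0// => /le_trans; apply.
by rewrite [leRHS]mulrC ler_wpM2r// exprn_ge0// ltW.
Qed.

Section stability.
Context {R : realType} {N : nat}.

Lemma coord_le_enorm n (x : 'rV[R]_n) i : `|x ord0 i| <= enorm x.
Proof.
rewrite -[leLHS]ger0_norm// -[leLHS]sqrtr_sqr /enorm ler_wsqrtr//.
rewrite (bigD1 i)//= real_normK ?num_real// lerDl.
by apply: sumr_ge0 => j _; exact: sqr_ge0.
Qed.

Lemma compact_enorm_ball n (r : R) : compact [set x : 'rV[R]_n | enorm x <= r].
Proof.
have := @rV_compact R n (fun=> `[- r, r]%classic) (fun=> @segment_compact _ _ _).
move=> cbox; apply: (subclosed_compact _ cbox).
  apply: (@closed_comp _ _ (@enorm R n) [set s | s <= r]); last exact: closed_le.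
  by move=> x _; exact: enorm_continuous.
move=> x /= xr i; rewrite in_itv/= -ler_norml.
exact: le_trans (coord_le_enorm x i) xr.
Qed.

Lemma compact_coord_bounded n (A : set 'rV[R]_n) : compact A ->
  exists M, forall x, A x -> forall i, `|x ord0 i| <= M.
Proof.
move=> /compact_bounded[M [_ HM]]; pose M' := `|M| + 1.
have MM : M < M' by rewrite ltr_pwDr// ler_norm.
have M0 : 0 < M' by rewrite ltr_wpDl.
exists (M' + 1) => x Ax i.
have : ball (0 : 'rV[R]_n) (M' + 1) x.
  rewrite mx_norm_ball /ball_/= sub0r normrN.
  by apply: (le_lt_trans (HM _ MM _ Ax)); rewrite ltrDl.
by move=> [_ /(_ ord0 i)]; rewrite /ball/= mxE sub0r normrN => /ltW.
Qed.

Lemma gaussian_decay_stable (m : nat) (u : R -> R) (e r1 : R) : odd m ->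
  continuous (@radial R N.+1 u) -> 0 < e ->
  (forall r, r1 <= r -> u r <= - e * r ^+ 2) ->
  stable_outside_compact m (@radial R N.+1 u).
Proof.
move=> mo cu e0 ur.
(* This is [n + m], the exponent in [rellich_gradient]. *)
pose J := (N.+1 + (m.-1)./2.*2).+1.
have mE : ((m.-1)./2.*2).+1 = m.
  by case: m mo {J} => // m /= /negbTE mo; rewrite -[in RHS](odd_double_half m) mo.
have [R0 [R01 HR0]] := @exp_dominates_power R e J m e0.
(* [R0 >= 1] keeps the support of test functions off the unit ball, as [hardy] requires, and [r1] is
   where the decay of [u] begins. *)
pose R1 := Num.max R0 r1.
exists [set x | enorm x <= R1]; split; first exact: compact_enorm_ball.
move=> phi [Cphi comp away]; pose C := closure [set x | phi x != 0].
have enormC x : C x -> R1 < enorm x.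
  by move=> /away /= /negP; rewrite -ltNge.
have farC x : C x -> 1 <= sqnorm x.
  move=> /enormC xR; rewrite -sqr_enorm exprn_ege1// ltW// (le_lt_trans _ xR)//.
  by rewrite le_max R01.
have bC := compact_coord_bounded comp.
have closedC : closed C by exact: closed_closure.
have S : smooth_in C phi.
  split=> // x Cx; apply/eqP/negPn/negP => phix; apply: Cx.
  exact: subset_closure.
have rel := rellich_gradient closedC bC farC (m.-1)./2 S.
have cG := sqnorm_grad_cc closedC bC (m.-1)./2 S.
have cphi2 : compactly_supported (fun x => phi x * phi x).
  apply: (@compactly_supportedM R N.+1 phi phi); first exact: (smooth_in_cc bC S).
  by move=> x; exact: (Ck_continuous (Cphi 0%N)).
have cexp : continuous (fun x : 'rV[R]_N.+1 => expR (radial u x)).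
  move=> x; apply: (@for_continuous_comp _ _ (@expR R) (radial u)); first exact: cu.
  exact: continuous_expR.
have cB : compactly_supported (fun x => expR (radial u x) * phi x ^+ 2).
  have -> : (fun x => expR (radial u x) * phi x ^+ 2) =
      (fun x => expR (radial u x) * (phi x * phi x)).
    by apply/funext => x; rewrite expr2.
  exact: compactly_supportedM.
have cW : compactly_supported (fun x => weight x ^+ J * phi x ^+ 2).
  exact: (weight_sqr_cc bC J S).
have pw x : 4 ^+ m * (expR (radial u x) * phi x ^+ 2) <= weight x ^+ J * phi x ^+ 2.
  have [Cx|/S.2 ->] := pselect (C x); last by rewrite expr0n !mulr0.
  rewrite mulrA; apply: ler_wpM2r; first exact: sqr_ge0.
  have xR := enormC x Cx.
  have [x0 x1] : R0 <= enorm x /\ r1 <= enorm x.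
    by split; rewrite ltW// (le_lt_trans _ xR)// le_max lexx ?orbT.
  have y0 : 0 < 1 + sqnorm x by rewrite ltr_pwDl// sqnorm_ge0.
  rewrite /weight exprVn -[leRHS]mul1r ler_pdivlMr ?exprn_gt0//.
  have := HR0 _ x0; rewrite sqr_enorm => h.
  have ux : expR (radial u x) <= (expR (e * sqnorm x))^-1.
    by rewrite -expRN ler_expR -mulNr -sqr_enorm; exact: ur.
  rewrite mulrAC; apply: (le_trans (ler_pM _ _ h ux)).
  - by rewrite mulr_ge0 ?exprn_ge0// ltW.
  - exact: expR_ge0.
  - by rewrite divff// gt_eqF// expR_gt0.
have c4B := compactly_supportedM cB (@cst_continuous _ _ (4 ^+ m : R)).
have le1 := Rintegral_Rn_le c4B cW pw.
have eB := Rintegral_RnZ (4 ^+ m) cB.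
rewrite (integral_RnE cG) (integral_RnE cB) -EFinB lee_fin subr_ge0.
have m4 : (0 : R) < 4 ^+ m by rewrite exprn_gt0.
rewrite -(ler_pM2l m4) -{1}eB; apply: (le_trans le1); apply: (le_trans rel).
by rewrite mE.
Qed.

End stability.

Theorem theorem3p4 (R : realType) (n m : nat) (hn : (1 <= n)%N)
    (hm : (3 <= m)%N) (hodd : odd m) (alpha : 'I_m -> R)
    (halpha : exists2 k : 'I_m, (1 <= k)%N & Num.sg (alpha k) != (-1) ^+ k)
    (T : \bar R) (u : R -> R) (hu : maximal_radial_solution n alpha T u) :
  T = +oo%E /\ entire_solution m (@radial R n u) /\
  stable_outside_compact m (@radial R n u).
Proof.
case: n hn hu => // N _ hu.
have Too := maximal_solution_global hodd hu; split=> //.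
have sol : radial_solution N.+1 alpha +oo%E u by rewrite -Too; case: hu.
split; first exact: (global_entire_solution hodd sol).
have [e [r1 [e0 _ ur]]] := global_decay hodd sol halpha.
apply: gaussian_decay_stable hodd _ e0 ur => x.
exact: (Ck_continuous (global_Ck sol)).
Qed.
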